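(* Let $T$ be a tree with $m\geq 2$ vertices, let $S$ be a subset of the vertex set of $T$, and let $n$ be an integer with $n\geq |S|\geq 2$. Then the complex $\mathcal{S}tr(T,S,n)$ is homotopy equivalent to a wedge of $(n-|S|)$-dimensional spheres, and the number of spheres is $f(|S|,n)$, where $f(k,n)=\sum_{\alpha=1}^{k-1}(-1)^{k+\alpha+1}\binom{k}{\alpha+1}\alpha^n$.
   Context: A tree $T$ is viewed as a $1$-dimensional cell complex. The cubical complex $T^n$ has as cells the $n$-tuples $c=(c_1,\dots,c_n)$ where each $c_i$ is a vertex or an edge of $T$; the dimension of $c$ is the number of entries that are edges, and boundary cells are obtained by replacing some edge entries by one of their endpoints. For a cell $c$ of $T^n$, $\mathrm{supp}\,c$ is the set of vertices $v$ of $T$ such that $c_k=v$ for some $k$. For a subset $S$ of the vertices, $\mathcal{S}tr(T,S,n)$ is the subcomplex of $T^n$ consisting of all cells $c$ with $S\subseteq \mathrm{supp}\,c$. A wedge of $k$ copies of the $0$-sphere means a discrete space with $k+1$ points. *)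

(* Defs.v *)
From HB Require Import structures.
From mathcomp Require Import all_boot all_order all_algebra.
From mathcomp Require Import all_classical all_reals all_analysis.
From mathcomp Require Import homotopy.

Set Implicit Arguments.
Unset Strict Implicit.
Unset Printing Implicit Defensive.

Import Order.TTheory GRing.Theory Num.Theory.
Import numFieldNormedType.Exports.

Local Open Scope classical_set_scope.
Local Open Scope ring_scope.

Definition homotopic (R : realType) (X Y : topologicalType) (f g : X -> Y) :=
  exists H : X * R -> Y,
    [/\ {within [set: X] `*` `[0, 1], continuous H},
        forall x, H (x, 0) = f x
      & forall x, H (x, 1) = g x].

Definition homotopy_equivalent (R : realType) (X Y : topologicalType) :=
  exists (f : X -> Y) (g : Y -> X),
    [/\ continuous f, continuous g,
        homotopic R (g \o f) idfun & homotopic R (f \o g) idfun].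

Definition sphere (R : realType) (d : nat) : set 'rV[R]_d.+1 :=
  [set x | \sum_i x 0 i ^+ 2 = 1].
Arguments sphere : clear implicits.

Lemma sphere_base_subproof (R : realType) (d : nat) :
  delta_mx 0 0 \in sphere R d.
Proof.
apply/mem_set; rewrite /sphere /= (bigD1 0) //= mxE !eqxx expr1n big1 ?addr0 //.
by move=> i i0; rewrite mxE (negPf i0) andbF expr0n.
Qed.

Definition sphere_base (R : realType) (d : nat) : sphere R d :=
  SigSub (sphere_base_subproof R d).

(* Beware that [wedge] over an empty family is empty, not a point, so this is
   the wedge of N spheres only for N > 0. *)
Definition wedge_spheres (R : realType) (d N : nat) : topologicalType :=
  @wedge 'I_N (fun=> set_type (sphere R d)) (fun=> sphere_base R d).

(* A tree is given by the adjacency relation [e] on its finite vertex set.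
   Any edge {u, v} yields the duplicate-free e-cycle [:: u; v], hence the bound
   2 in the absence of circuits. *)
Definition is_tree (V : finType) (e : rel V) : Prop :=
  [/\ symmetric e, irreflexive e, (0 < #|V|)%N,
      forall x y, connect e x y
    & forall p : seq V, ucycle e p -> (size p <= 2)%N].

Section CubicalComplex.
Variables (V : finType) (e : rel V) (n : nat).

(* Vertices and edges of T are identified with their sets of endpoints. *)
Definition is_vertex (A : {set V}) := [exists v, A == [set v]%SET].
Definition is_edge (A : {set V}) :=
  [exists u, exists v, e u v && (A == [set u; v]%SET)].

Definition is_cell (c : {ffun 'I_n -> {set V}}) :=
  [forall k, is_vertex (c k) || is_edge (c k)].

Definition supp (c : {ffun 'I_n -> {set V}}) : {set V} :=
  [set v | [exists k, c k == [set v]%SET]]%SET.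

Definition Str (S : {set V}) : {set {ffun 'I_n -> {set V}}} :=
  [set c | is_cell c && (S \subset supp c)]%SET.

End CubicalComplex.

Section Realization.
Variables (R : realType) (V : finType) (n : nat).

(* Points of T are written in barycentric coordinates: the closed cell of T
   with endpoint set A is the simplex spanned by the basis vectors of R^V
   indexed by A. *)
Definition closed_cell1 (A : {set V}) : set {ptws V -> R} :=
  [set p | [/\ forall v, 0 <= p v, \sum_v p v = 1
             & forall v, v \notin A -> p v = 0]].

Definition closed_cell (c : {ffun 'I_n -> {set V}}) :
    set {ptws 'I_n -> {ptws V -> R}} :=
  [set x | forall k, closed_cell1 (c k) (x k)].

Definition realization (K : {set {ffun 'I_n -> {set V}}}) :
    set {ptws 'I_n -> {ptws V -> R}} :=
  \bigcup_(c in [set` K]) closed_cell c.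

End Realization.
Arguments realization R {V n} K _.

(* [set_type] carries the subspace topology. *)
Definition Str_space (R : realType) (V : finType) (e : rel V) (n : nat)
    (S : {set V}) : topologicalType :=
  set_type (realization R (Str e n S)).

Definition num_spheres (k n : nat) : int :=
  \sum_(1 <= a < k) (-1) ^+ (k + a + 1) * ('C(k, a.+1) * a ^ n)%:Z.

(* Main.v *)
Require Import Defs.
From HB Require Import structures.
From mathcomp Require Import all_boot all_order all_algebra.
From mathcomp Require Import all_classical all_reals all_analysis.
From mathcomp Require Import homotopy.
From mathcomp Require Import ring lra zify.

Set Implicit Arguments.
Unset Strict Implicit.
Unset Printing Implicit Defensive.

Import Order.TTheory GRing.Theory Num.Theory.
Import numFieldNormedType.Exports.
Local Open Scope classical_set_scope.
Local Open Scope ring_scope.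

(* The realization is the space of all n-tuples of points of the tree T that
   hit every point of S. Trees are absolute extensors, so that a map between
   two trees that is prescribed on the marked points exists and is unique up to
   homotopy relative to them. Hence T can be replaced with the interval
   [0, |S| - 1], marked at its integers, and the realization with a subset of a
   cube, X_n(S). Splitting off the first coordinate, X_{n+1}(S) is the union of
   J x X_n(S), where J is the interval, and of {t} x X_n(S - t) for t in S. This
   suggests a recursive choice of open top-dimensional cells, whose number obeys
   f(k, n+1) = (k-1) f(k, n) + k f(k-1, n), such that the complement X'_n(S) of
   these cells is an absolute extensor: for dimension reasons X_n(S) is
   contained in X'_n(S - t), so that X'_{n+1}(S) is obtained by gluing absolute
   extensors along absolute extensors. As X'_n(S) is contractible, crushing it
   to a point is a homotopy equivalence onto a wedge of spheres. *)

(** The choice of the removed cells. If |S| is the number of coordinates, X_n(S) is the finite set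
    of arrangements of S, and all of them but the increasing one are removed. Otherwise, each slice
    {t} x X_n(S - t) loses {t} times the removed cells of X_n(S - t), and J x X_n(S) loses (t - 1,
    t) times the removed cells of X_n(S), for every t in S but the least. These k - 1 edges cut J
    into k gaps with one marked point each. This is the point: X_n(S) is not an extensor in general,
    but now it is only needed over a gap, where gap x X_n(S) is closed off at t by the extensor {t}
    x X'_n(S - t). What is left is J x X'_n(S) with k such pieces attached, each along gap x
    X'_n(S). Extensors are preferred to contractible sets because both the passage from T to the
    interval and the contraction of X' become extension problems: the values are prescribed at times
    0 and 1 and on the marked points or on the cell boundaries. *)

(** * Maps that are continuous on closed sets, and their gluing *)

Section ContinuityOnClosedSets.
Implicit Types X Y Z : topologicalType.

(* For closed A, continuity of the restriction of f to A. *)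
Definition continuous_on X Y (A : set X) (f : X -> Y) :=
  forall C, closed C -> closed (A `&` f @^-1` C).

Lemma continuous_on_within X Y (A : set X) (f : X -> Y) :
  closed A -> continuous_on A f <-> {within A, continuous f}.
Proof.
move=> cA; rewrite continuous_closedP; split=> h C cC; move/h: (cC).
  by rewrite setIC closed_setIS.
by move=> hC; rewrite setIC closed_setIS.
Qed.

Lemma continuous_onW X Y (A : set X) (f : X -> Y) :
  closed A -> continuous f -> continuous_on A f.
Proof. by move=> cA /continuous_closedP cf C cC; apply: closedI => //; exact: cf. Qed.

Lemma continuous_onT X Y (f : X -> Y) : continuous_on setT f -> continuous f.
Proof. by move=> h; apply/continuous_closedP => C /h; rewrite setTI. Qed.

Lemma continuous_on_closed X Y (A : set X) (f : X -> Y) : continuous_on A f -> closed A.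
Proof. by move=> /(_ setT closedT); rewrite preimage_setT setIT. Qed.

Lemma continuous_on_eq X Y (A : set X) (f g : X -> Y) :
  {in A, f =1 g} -> continuous_on A f -> continuous_on A g.
Proof.
move=> fg cf C /cf; congr closed; apply/seteqP; split=> x [Ax /=].
  by rewrite fg ?inE.
by rewrite -fg ?inE.
Qed.

Lemma continuous_onS X Y (A B : set X) (f : X -> Y) : closed B -> B `<=` A -> continuous_on A f -> continuous_on B f.
Proof.
move=> cB BA cf C /cf cC; have -> : B `&` f @^-1` C = B `&` (A `&` f @^-1` C).
  by rewrite setIA (setIidl BA).
exact: closedI.
Qed.

Lemma continuous_onU X Y (A B : set X) (f : X -> Y) : continuous_on A f -> continuous_on B f -> continuous_on (A `|` B) f.
Proof. by move=> cA cB C cC; rewrite setIUl; apply: closedU; [exact: cA|exact: cB]. Qed.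

Lemma continuous_on_comp X Y Z (A : set X) (B : set Y) (f : X -> Y) (g : Y -> Z) :
  continuous_on A f -> continuous_on B g -> {homo f : x / A x >-> B x} -> continuous_on A (g \o f).
Proof.
move=> cf cg fAB C /cg/cf; congr closed; apply/seteqP; split=> x [Ax /=]; first by case.
by move=> Cgf; split=> //; split => //; exact: fAB.
Qed.

Lemma continuous_on_compT X Y Z (A : set X) (f : X -> Y) (g : Y -> Z) :
  continuous_on A f -> continuous g -> continuous_on A (g \o f).
Proof. by move=> cf cg; apply: (continuous_on_comp (B := setT)) => //; exact: continuous_onW. Qed.

Lemma continuous_on_pair X Y Z (A : set X) (f : X -> Y) (g : X -> Z) :
  continuous_on A f -> continuous_on A g -> continuous_on A (fun x => (f x, g x)).
Proof.
move=> cf; have cA := continuous_on_closed cf; move: cf; rewrite !continuous_on_within // => cf cg x.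
by apply: cvg_pair; [exact: cf|exact: cg].
Qed.

Definition glue X Y (A : set X) (f g : X -> Y) (x : X) :=
  if pselect (A x) then f x else g x.

Lemma glue_in X Y (A : set X) (f g : X -> Y) x : A x -> glue A f g x = f x.
Proof. by rewrite /glue; case: pselect. Qed.

Lemma glue_notin X Y (A : set X) (f g : X -> Y) x : ~ A x -> glue A f g x = g x.
Proof. by rewrite /glue; case: pselect. Qed.

Lemma glue_out X Y (A B : set X) (f g : X -> Y) x :
  (forall x, A x -> B x -> f x = g x) -> B x -> glue A f g x = g x.
Proof. by rewrite /glue; case: pselect => //= Ax fg Bx; exact: fg. Qed.

Lemma continuous_on_glue X Y (A B : set X) (f g : X -> Y) :
  (forall x, A x -> B x -> f x = g x) -> continuous_on A f -> continuous_on B g ->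
  continuous_on (A `|` B) (glue A f g).
Proof.
move=> fg cf cg; apply: continuous_onU.
  by apply: continuous_on_eq cf => x /set_mem Ax; rewrite glue_in.
by apply: continuous_on_eq cg => x /set_mem Ax; rewrite (glue_out fg).
Qed.

End ContinuityOnClosedSets.

(** * Absolute extensors for perfectly normal spaces: the gluing lemma and intervals *)

Section AbsoluteExtensors.
Variable R : realType.
Implicit Types X Y Z E : topologicalType.

(** This is the zero-set form of perfect normality. It gives what the gluing of extensors and
    Tietze's theorem ask of a test space, and it passes to a space of functions without a choice of
    metric there. *)
Definition perfectly_normal Z := forall C : set Z, closed C ->
  exists2 u : Z -> R, continuous u & C = [set z | u z = 0].

Lemma perfectly_normal_section Z Y (s : Z -> Y) (r : Y -> Z) :
  continuous s -> continuous r -> cancel s r -> perfectly_normal Y -> perfectly_normal Z.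
Proof.
move=> cs cr sK pY C cC; have : closed (r @^-1` C).
  by move/continuous_closedP : cr => /(_ C cC).
move=> /pY[u cu uE]; exists (u \o s).
  by move=> z; apply: continuous_comp; [exact: cs|exact: cu].
apply/seteqP; split=> z /=.
  move=> Cz; suff : (r @^-1` C) (s z) by rewrite uE.
  by rewrite /= sK.
move=> uz; have : (r @^-1` C) (s z) by rewrite uE.
by rewrite /= sK.
Qed.

Lemma contract_continuous : continuous (@contract R).
Proof.
move=> x; apply/cvgrPdist_lt => e e0.
have : nbhs (x : \bar R) (ball (x : \bar R) e) by apply/nbhs_ballP; exists e.
exact: filterS.
Qed.

(** The distance to [C] may be infinite, for instance if [C] is empty; [contract] makes it real and
    keeps its zeros. *)
Lemma pseudometric_perfectly_normal (Z : pseudoMetricType R) : perfectly_normal Z.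
Proof.
move=> C cC; exists (@contract R \o edist_inf C).
  move=> z; apply: continuous_comp; [exact: edist_inf_continuous|exact: contract_continuous].
apply/seteqP; split=> z /=; first by move=> Cz; rewrite edist_inf0 // contract0.
move/eqP; rewrite contract_eq0 => /eqP z0; apply: cC => U /nbhs_ballP[e /= e0 zU].
have /ereal_inf_lt[_ [a Ca <-] az] : (edist_inf C z < e%:E)%E by rewrite z0 lte_fin.
by exists a; split=> //; apply: zU; exact: (edist_lt_ball az).
Qed.

(** With [u] and [v] in the role of the distances to [A] and [B], the points of [P] are at least as
    close to [A], those of [Q] at least as close to [B]. As [A] and [B] may overlap, the gain is
    that the interface of [P] and [Q] meets either of them only in their intersection. *)
Lemma perfectly_normal_separation Z (A B : set Z) : perfectly_normal Z -> closed A -> closed B ->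
  exists P Q : set Z, [/\ closed P, closed Q, P `|` Q = setT,
    A `<=` P /\ B `<=` Q & P `&` B `<=` A /\ Q `&` A `<=` B].
Proof.
move=> pZ /pZ[u cu ->] /pZ[v cv ->].
have cau : continuous (fun z => `|v z| - `|u z|).
  move=> z; apply: cvgB; apply: cvg_norm; [exact: cv|exact: cu].
exists [set z | 0 <= `|v z| - `|u z| ], [set z | `|v z| - `|u z| <= 0]; split.
- exact: (proj1 (continuous_closedP _) cau _ (@closed_ge _ 0)).
- exact: (proj1 (continuous_closedP _) cau _ (@closed_le _ 0)).
- by apply/seteqP; split=> // z _; case: (leP 0 (`|v z| - `|u z|)) => [|/ltW]; [left|right].
- split=> z /= ->; rewrite normr0 ?subr0 ?normr_ge0 // sub0r oppr_le0.
- split=> z [] /= + z0; rewrite z0 normr0 ?sub0r ?subr0 ?oppr_ge0 normr_le0.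
    by move/eqP.
  by move/eqP.
Qed.

Lemma perfectly_normal_normal Z : perfectly_normal Z -> normal_space Z.
Proof.
move=> pZ; apply/(@normal_openP R) => A B cA cB AB0.
have [P [Q [cP cQ PQ [AP BQ] [PB QA]]]] := perfectly_normal_separation pZ cA cB.
exists (~` Q), (~` P); split; rewrite ?openC // ?closedC //.
- move=> x Ax Qx; suff : (A `&` B) x by rewrite AB0.
  by split=> //; exact: QA.
- move=> x Ax Px; suff : (A `&` B) x by rewrite AB0.
  by split=> //; exact: PB.
- by rewrite -setCU setUC PQ setCT.
Qed.

(** That [C] is closed is part of [continuous_on]. As [C] may be empty, an absolute extensor has a
    point; a base point is found in this way later. *)
Definition absolute_extensor E (K : set E) := forall Z, perfectly_normal Z ->
  forall (C : set Z) (f : Z -> E), continuous_on C f -> {homo f : z / C z >-> K z} ->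
  exists g : Z -> E, [/\ continuous g, {in C, g =1 f} & forall z, K (g z)].

(** First [f] is extended with values in both sets, and the result [h] is kept on the interface of
    the two halves [P] and [Q]. From there on the halves are independent extension problems, into
    [K] and into [L]. *)
Lemma AE_glue E (K L : set E) : closed K -> closed L ->
  absolute_extensor K -> absolute_extensor L -> absolute_extensor (K `&` L) -> absolute_extensor (K `|` L).
Proof.
move=> cK cL aK aL aKL Z pZ C f cf fKL.
pose CK := C `&` f @^-1` K; pose CL := C `&` f @^-1` L.
have [P [Q [cP cQ PQT [CKP CLQ] [PCL QCK]]]] := perfectly_normal_separation pZ (cf _ cK) (cf _ cL).
have CI : closed (CK `&` CL) by apply: closedI; exact: cf.
have [h [ch hf hKL]] : exists h : Z -> E,
    [/\ continuous h, {in CK `&` CL, h =1 f} & forall z, (K `&` L) (h z)].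
  apply: aKL => //; first by apply: (continuous_onS _ _ cf) => // x [[]].
  by move=> z [[_ ?] [_ ?]].
have [gK [cgK gKf gKK]] : exists g : Z -> E,
    [/\ continuous g, {in CK `|` (P `&` Q), g =1 glue CK f h} & forall z, K (g z)].
  have fh x : CK x -> (P `&` Q) x -> f x = h x.
    by move=> Cx [Px Qx]; rewrite hf // inE; split => //; exact: QCK.
  apply: aK => //.
    apply: continuous_on_glue => //; first by apply: (continuous_onS _ _ cf); [exact: cf|exact: subIsetl].
    by apply: continuous_onW => //; exact: closedI.
  move=> z [Cz|PQz]; first by rewrite glue_in //; case: Cz.
  by rewrite (glue_out fh) //; case: (hKL z).
have [gL [cgL gLf gLL]] : exists g : Z -> E,
    [/\ continuous g, {in CL `|` (P `&` Q), g =1 glue CL f h} & forall z, L (g z)].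
  have fh x : CL x -> (P `&` Q) x -> f x = h x.
    by move=> Cx [Px Qx]; rewrite hf // inE; split => //; exact: PCL.
  apply: aL => //.
    apply: continuous_on_glue => //; first by apply: (continuous_onS _ _ cf); [exact: cf|exact: subIsetl].
    by apply: continuous_onW => //; exact: closedI.
  move=> z [Cz|PQz]; first by rewrite glue_in //; case: Cz.
  by rewrite (glue_out fh) //; case: (hKL z).
(* On the interface, both maps are glued from [f] and the same [h], and there [CK] and [CL]
   coincide. *)
have gKL x : P x -> Q x -> gK x = gL x.
  move=> Px Qx; rewrite gKf ?gLf ?inE; try by right.
  have [Cx|nCx] := pselect (C x); last first.
    by rewrite !glue_notin // => -[/nCx].
  case: (fKL x Cx) => ?.
    have CKx : CK x by [].
    by rewrite !glue_in //; apply: QCK.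
  have CKx : CL x by [].
  by rewrite !glue_in //; apply: PCL.
exists (glue P gK gL); split.
- apply: continuous_onT; rewrite -PQT; apply: continuous_on_glue => //; exact: continuous_onW.
- move=> z /set_mem Cz; case: (fKL z Cz) => h1.
    have CKx : CK z by [].
    by rewrite glue_in ?gKf ?glue_in //; [rewrite inE; left|exact: CKP].
  have CKx : CL z by [].
  by rewrite (glue_out gKL) ?gLf ?glue_in //; [rewrite inE; left|exact: CLQ].
- move=> z; have [Pz|nPz] := pselect (P z); first by left; rewrite glue_in.
  by right; rewrite glue_notin.
Qed.

Lemma AE_retract E E' (K : set E) (K' : set E') (a : E -> E') (b : E' -> E) :
  closed K -> absolute_extensor K -> continuous_on K a -> continuous_on K' b ->
  {homo a : x / K x >-> K' x} -> {homo b : x / K' x >-> K x} ->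
  {in K', cancel b a} -> absolute_extensor K'.
Proof.
move=> cK aK ca cb aKK bKK bK Z pZ C f cf fC.
have [g [cg gf gK]] : exists g : Z -> E,
    [/\ continuous g, {in C, g =1 b \o f} & forall z, K (g z)].
  apply: aK => //; first exact: (continuous_on_comp _ cb).
  by move=> z Cz /=; apply/bKK/fC.
exists (a \o g); split.
- apply: continuous_onT; apply: (continuous_on_comp _ ca) => //.
  exact: continuous_onW.
- by move=> z Cz /=; rewrite gf //= bK // inE; apply: fC; exact: set_mem.
- by move=> z; exact: aKK.
Qed.

Lemma AE_set1 E (x : E) : absolute_extensor [set x].
Proof.
move=> Z pZ C f cf fx; exists (fun=> x); split=> //; first exact: cst_continuous.
by move=> z /set_mem /fx <-.
Qed.

Definition clamp (a b x : R) := Num.max a (Num.min b x).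

Lemma clamp_continuous a b : continuous (clamp a b).
Proof.
by move=> x; apply: continuous_max; [exact: cvg_cst|apply: continuous_min; [exact: cvg_cst|exact: cvg_id]].
Qed.

Lemma clamp_itv a b x : a <= b -> a <= clamp a b x <= b.
Proof. by move=> ab; rewrite /clamp le_max lexx ge_max ab ge_min lexx. Qed.

Lemma clamp_id a b x : a <= x <= b -> clamp a b x = x.
Proof. by case/andP=> ax xb; rewrite /clamp min_r // max_r. Qed.

Lemma AE_itv (a b : R) : a <= b -> absolute_extensor [set x | a <= x <= b].
Proof.
(* A bound for the absolute values on the interval, with 1 added to make it positive, as Tietze's
   theorem requires. The extension may leave the interval and is clamped back. *)
move=> ab Z pZ C f cf fab; pose M := `|a| + `|b| + 1.
have M0 : 0 < M by rewrite /M ltr_wpDl ?addr_ge0.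
have [g [gf cg _]] : exists g : Z -> R, [/\ {in C, f =1 g}, continuous g & forall z, `|g z| <= M].
  have cC := continuous_on_closed cf.
  apply: continuous_bounded_extension => //; first exact: perfectly_normal_normal.
    exact/continuous_on_within.
  move=> z /fab /= /andP[az zb]; rewrite ler_norml /M.
  have := ler_norm b; have := ler_norm (- a); rewrite normrN.
  have := normr_ge0 a; have := normr_ge0 b.
  by move=> *; apply/andP; split; lra.
exists (clamp a b \o g); split.
- by move=> z; apply: continuous_comp; [exact: cg|exact: clamp_continuous].
- by move=> z Cz /=; rewrite -gf // clamp_id //; apply: fab; exact: set_mem.
- by move=> z; apply: clamp_itv.
Qed.

End AbsoluteExtensors.

(** * Row vectors: products, boxes, and cylinders with a widened slice *)

Section Rows.
Variable R : realType.

Lemma continuous_row (Z : topologicalType) n (f : Z -> 'rV[R]_n) :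
  (forall i, continuous (fun z => f z 0 i)) -> continuous f.
Proof.
move=> cf z U [P Pf PU].
have : \forall w \near z, forall i, P 0 i (f w 0 i).
  by apply: filter_forall => i; apply: (cf i z); exact: Pf.
by apply: filterS => w Pw; apply: PU => i j; rewrite ord1; exact: Pw.
Qed.

Lemma entry_continuous n (i : 'I_n) : continuous (fun x : 'rV[R]_n => x 0 i).
Proof. exact: coord_continuous. Qed.

Lemma closed_row1 n (x : 'rV[R]_n) : closed [set x].
Proof. exact/accessible_closed_set1/hausdorff_accessible/norm_hausdorff. Qed.

Definition row_head n (x : 'rV[R]_n.+1) := x 0 0.
Definition row_tail n (x : 'rV[R]_n.+1) : 'rV[R]_n := \row_i x 0 (lift 0 i).
Definition row_cons n (a : R) (x : 'rV[R]_n) : 'rV[R]_n.+1 :=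
  \row_i (if unlift 0 i is Some j then x 0 j else a).

Lemma row_head_cons n a (x : 'rV[R]_n) : row_head (row_cons a x) = a.
Proof. by rewrite /row_head mxE unlift_none. Qed.

Lemma row_tail_cons n a (x : 'rV[R]_n) : row_tail (row_cons a x) = x.
Proof. by apply/rowP => i; rewrite !mxE liftK. Qed.

Lemma row_cons_head_tail n (x : 'rV[R]_n.+1) : row_cons (row_head x) (row_tail x) = x.
Proof. by apply/rowP => i; rewrite mxE; case: unliftP => [j ->|->]; rewrite ?mxE. Qed.

Lemma row_head_continuous n : continuous (@row_head n).
Proof. exact: entry_continuous. Qed.

Lemma row_tail_continuous n : continuous (@row_tail n).
Proof.
apply: continuous_row => i; under eq_fun do rewrite mxE.
exact: entry_continuous.
Qed.

Lemma forall_ord_recl n (P : 'I_n.+1 -> Prop) :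
  (forall i, P i) <-> P 0 /\ forall i, P (lift 0 i).
Proof.
split=> [h|[P0 PS] i]; first by split.
by case: (unliftP 0 i) => [j ->|->].
Qed.

Lemma exists_ord_recl n (P : 'I_n.+1 -> Prop) :
  (exists i, P i) <-> P 0 \/ exists i, P (lift 0 i).
Proof.
split=> [[i]|[P0|[i Pi]]]; [|by exists 0|by exists (lift 0 i)].
by case: (unliftP 0 i) => [j ->|->]; [right; exists j|left].
Qed.

Definition head_tail_set n (A : set R) (B : set 'rV[R]_n) : set 'rV[R]_n.+1 :=
  [set x | A (row_head x) /\ B (row_tail x)].

Lemma closed_head_tail_set n A (B : set 'rV[R]_n) : closed A -> closed B -> closed (head_tail_set A B).
Proof.
move=> cA cB; apply: closedI.
  exact: (proj1 (continuous_closedP _) (@row_head_continuous n) A cA).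
exact: (proj1 (continuous_closedP _) (@row_tail_continuous n) B cB).
Qed.

Lemma AE_rows n (A : 'I_n -> set R) : (forall i, absolute_extensor R (A i)) ->
  absolute_extensor R [set x : 'rV[R]_n | forall i, A i (x 0 i)].
Proof.
move=> aA Z pZ C f cf fA.
have /choice[g gP] : forall i, exists g : Z -> R,
    [/\ continuous g, {in C, g =1 (fun z => f z 0 i)} & forall z, A i (g z)].
  move=> i; apply: aA => //; first exact: (continuous_on_compT cf (@entry_continuous n i)).
  by move=> z /fA.
exists (fun z => \row_i g i z); split.
- apply: continuous_row => i; under eq_fun do rewrite mxE.
  by case: (gP i).
- by move=> z Cz; apply/rowP => i; rewrite mxE; case: (gP i) => _ ->.
- by move=> z i; rewrite mxE; case: (gP i).
Qed.

Lemma AE_head_tail_set n A (B : set 'rV[R]_n) : absolute_extensor R A -> absolute_extensor R B -> absolute_extensor R (head_tail_set A B).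
Proof.
move=> aA aB Z pZ C f cf fA.
have [g [cg gf gA]] : exists g : Z -> R,
    [/\ continuous g, {in C, g =1 @row_head n \o f} & forall z, A (g z)].
  apply: aA => //; first exact: (continuous_on_compT cf (@row_head_continuous n)).
  by move=> z /fA[].
have [h [ch hf hA]] : exists h : Z -> 'rV[R]_n,
    [/\ continuous h, {in C, h =1 @row_tail n \o f} & forall z, B (h z)].
  apply: aB => //; first exact: (continuous_on_compT cf (@row_tail_continuous n)).
  by move=> z /fA[].
exists (fun z => row_cons (g z) (h z)); split.
- apply: continuous_row => i; under eq_fun do rewrite mxE.
  case: unliftP => [j _|_]; last exact: cg.
  by move=> z; exact: (@continuous_comp _ _ _ h (fun x : 'rV[R]_n => x 0 j) z (ch z) (@entry_continuous n j _)).
- by move=> z Cz; rewrite gf // hf //= row_cons_head_tail.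
- by move=> z; split; rewrite ?row_head_cons ?row_tail_cons.
Qed.

Lemma closed_itv (a b : R) : closed [set x : R | a <= x <= b].
Proof.
have -> : [set x : R | a <= x <= b] = [set x | a <= x] `&` [set x | x <= b].
  by apply/seteqP; split=> x /=; [move/andP|case=> -> ->].
by apply: closedI; [exact: closed_ge|exact: closed_le].
Qed.

(** The pair consists of the lower and the upper corner. Empty boxes are allowed, so that two boxes
    always intersect in a box. *)
Definition box n (b : 'rV[R]_n * 'rV[R]_n) : set 'rV[R]_n :=
  [set x | forall i, b.1 0 i <= x 0 i <= b.2 0 i].

Lemma closed_box n (b : 'rV[R]_n * 'rV[R]_n) : closed (box b).
Proof.
have -> : box b = \bigcap_i [set x | b.1 0 i <= x 0 i <= b.2 0 i].
  by apply/seteqP; split=> x /= h i; [move=> _|]; apply: h.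
apply: closed_bigI => i _.
exact: (proj1 (continuous_closedP _) (@entry_continuous n i) _ (@closed_itv _ _)).
Qed.

Lemma AE_box n (b : 'rV[R]_n * 'rV[R]_n) : box b !=set0 -> absolute_extensor R (box b).
Proof.
move=> [x bx]; apply: (AE_rows (A := fun i => [set y | b.1 0 i <= y <= b.2 0 i])) => i.
apply: AE_itv; by case/andP: (bx i) => h1 h2; exact: le_trans h2.
Qed.

Definition boxI n (b c : 'rV[R]_n * 'rV[R]_n) : 'rV[R]_n * 'rV[R]_n :=
  (\row_i Num.max (b.1 0 i) (c.1 0 i), \row_i Num.min (b.2 0 i) (c.2 0 i)).

Lemma boxIE n (b c : 'rV[R]_n * 'rV[R]_n) : box (boxI b c) = box b `&` box c.
Proof.
apply/seteqP; split=> x /=.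
  move=> h; split=> i; have := h i; rewrite !mxE ge_max le_min;
  by case/andP => /andP[? ?] /andP[? ?]; apply/andP.
move=> [h1 h2] i; rewrite !mxE ge_max le_min.
by case/andP: (h1 i) => -> ->; case/andP: (h2 i) => -> ->.
Qed.

Definition boxes n (bs : seq ('rV[R]_n * 'rV[R]_n)) : set 'rV[R]_n :=
  [set x | exists2 b, b \in bs & box b x].

Lemma boxes0 n : boxes (@nil ('rV[R]_n * 'rV[R]_n)) = set0.
Proof. by apply/seteqP; split=> x // -[]. Qed.

Lemma boxes_cons n b (bs : seq ('rV[R]_n * 'rV[R]_n)) :
  boxes (b :: bs) = box b `|` boxes bs.
Proof.
apply/seteqP; split=> x.
  move=> [c]; rewrite inE => /orP[/eqP ->|cb] xc; [by left|by right; exists c].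
move=> [bx|[c cb xc]]; [exists b|exists c] => //; rewrite inE ?eqxx ?cb ?orbT //.
Qed.

Lemma boxes_cat n (bs cs : seq ('rV[R]_n * 'rV[R]_n)) :
  boxes (bs ++ cs) = boxes bs `|` boxes cs.
Proof.
elim: bs => [|b bs IH] /=; first by rewrite boxes0 set0U.
by rewrite !boxes_cons IH setUA.
Qed.

Lemma closed_boxes n (bs : seq ('rV[R]_n * 'rV[R]_n)) : closed (boxes bs).
Proof.
elim: bs => [|b bs IH]; first by rewrite boxes0; exact: closed0.
by rewrite boxes_cons; apply: closedU => //; exact: closed_box.
Qed.

Lemma boxes_map_boxI n b (bs : seq ('rV[R]_n * 'rV[R]_n)) :
  boxes (map (boxI b) bs) = box b `&` boxes bs.
Proof.
elim: bs => [|c bs IH]; first by rewrite boxes0 setI0.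
by rewrite /= !boxes_cons IH boxIE setIUr.
Qed.

(** In the recursion [G] is a gap with marked point [t], [B] the hitting set of [S], and [C] the
    core for [S] without [t]. The slice over [t] repairs a cylinder whose base need not be an
    extensor. *)
Definition capped_cylinder n (G : set R) (t : R) (B C : set 'rV[R]_n) : set 'rV[R]_n.+1 :=
  head_tail_set G B `|` head_tail_set [set t] C.

Lemma closed_capped_cylinder n G t (B C : set 'rV[R]_n) :
  closed G -> closed B -> closed C -> closed (capped_cylinder G t B C).
Proof.
by move=> cG cB cC; apply: closedU; apply: closed_head_tail_set => //.
Qed.

(* Gluing two such sets over B1 and B2 only requires the one over B1 `&` B2,
   so that finite unions of boxes reduce to a single box. *)
Lemma AE_capped_cylinder n (G : set R) t (C : set 'rV[R]_n) bs :
  closed G -> absolute_extensor R G -> G t -> closed C -> absolute_extensor R C -> boxes bs `<=` C ->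
  absolute_extensor R (capped_cylinder G t (boxes bs) C).
Proof.
(* The induction is on the length of the list, because intersecting with [box b] replaces [bs] by a
   different list of the same length. *)
move=> cG aG Gt cC aC; move: {2}(size bs) (erefl (size bs)) => k.
have cT : closed (head_tail_set [set t] C) by apply: closed_head_tail_set => //.
have aT : absolute_extensor R (head_tail_set [set t] C) by apply: AE_head_tail_set => //; exact: AE_set1.
elim: k bs => [|k IH] [|b bs] //=.
  move=> _ _; have -> : capped_cylinder G t (boxes [::]) C = head_tail_set [set t] C; last by [].
  by rewrite boxes0; apply/seteqP; split=> x; [case=> // -[]|right].
move=> [sk]; rewrite boxes_cons subUset => -[bC bsC].
have a1 : absolute_extensor R (capped_cylinder G t (box b) C).
  have [b0|] := pselect (box b !=set0); last first.
    move=> /set0P/negP; rewrite negbK => /eqP ->.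
    have -> : capped_cylinder G t set0 C = head_tail_set [set t] C; last by [].
    by apply/seteqP; split=> x; [case=> // -[]|right].
  apply: AE_glue => //; first by apply: closed_head_tail_set => //; exact: closed_box.
    by apply: AE_head_tail_set => //; exact: AE_box.
  have -> : head_tail_set G (box b) `&` head_tail_set [set t] C = head_tail_set [set t] (box b).
    apply/seteqP; split=> x; first by case=> [[_ ?] [? _]].
    by move=> [/= xt xb]; split; split=> //; [rewrite xt|exact: bC].
  by apply: AE_head_tail_set; [exact: AE_set1|exact: AE_box].
have -> : capped_cylinder G t (box b `|` boxes bs) C = capped_cylinder G t (box b) C `|` capped_cylinder G t (boxes bs) C.
  by apply/seteqP; split=> x; rewrite /capped_cylinder /head_tail_set /setU /=; tauto.
apply: AE_glue => //; [| |exact: IH|].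
- by apply: closed_capped_cylinder => //; exact: closed_box.
- by apply: closed_capped_cylinder => //; exact: closed_boxes.
have -> : capped_cylinder G t (box b) C `&` capped_cylinder G t (boxes bs) C = capped_cylinder G t (boxes (map (boxI b) bs)) C.
  rewrite boxes_map_boxI; apply/seteqP; split=> x; last first.
    by rewrite /capped_cylinder /head_tail_set /setU /setI /=; tauto.
  by rewrite /capped_cylinder /head_tail_set /setU /setI /=; have := bC (row_tail x); have := bsC (row_tail x); tauto.
by apply: IH; rewrite ?size_map // boxes_map_boxI => x [_ /bsC].
Qed.

End Rows.

(** * Words for the removed cells, and the gaps between the removed edges *)

Section Combinatorics.

(* A cell of the cube is a word with one letter per coordinate: 2t stands for
   the vertex t, and 2t - 1 for the edge from t - 1 to t. *)
Fixpoint removed_words (n : nat) (S : seq nat) : seq (seq nat) :=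
  if n isn't n'.+1 then [::] else
  if S == [::] then [::] else
  if size S == n then [seq map double p | p <- permutations S & p != S] else
  [seq t.*2 :: w | t <- S, w <- removed_words n' (rem t S)] ++
  [seq t.*2.-1 :: w | t <- behead S, w <- removed_words n' S].

Definition evens (w : seq nat) := [seq c <- w | ~~ odd c].

Lemma evens_double p : evens (map double p) = map double p.
Proof. by elim: p => //= a p IH; rewrite odd_double /= IH. Qed.

(** Every marked point but the first has an edge on its left; the truncated predecessors in
    [t.*2.-1] and [t.-1] are thus genuine ones. *)
Lemma sorted_gt0 S t : sorted ltn S -> t \in behead S -> (0 < t)%N.
Proof.
case: S => // s S /= /(order_path_min ltn_trans)/allP h /h; exact: leq_ltn_trans.
Qed.

(** A removed cell therefore has exactly one coordinate fixed at each marked point and an open edge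
    in every other coordinate: its dimension is [n - size S], that of the spheres, and its points
    hit all of [S]. *)
Lemma removed_words_wf n S m w : sorted ltn S -> all (fun s => s <= m)%N S -> (size S <= n)%N ->
  w \in removed_words n S -> [/\ size w = n, perm_eq (evens w) (map double S) &
    all (fun c => c <= m.*2)%N w].
Proof.
elim: n S w => [|n IH] S w //= srt am sz.
have uS : uniq S := sorted_uniq ltn_trans ltnn srt.
case: eqP => // /eqP S0; case: eqP => [sn|/eqP sn].
  move=> /mapP[p]; rewrite mem_filter mem_permutations => /andP[_ pS] ->.
  rewrite size_map (perm_size pS) sn evens_double perm_map //; split => //.
  rewrite all_map; apply/allP => x; rewrite (perm_mem pS) /= leq_double => /(allP am) //.
rewrite mem_cat => /orP[/allpairsPdep[t [v [tS vR ->]]]|/allpairsPdep[t [v [tS vR ->]]]].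
  have [||| sv pv av] := IH _ _ _ _ _ vR.
  - exact: (subseq_sorted ltn_trans (rem_subseq _ _)).
  - by apply/allP => x /mem_rem/(allP am).
  - by rewrite size_rem // -ltnS prednK //; case: (S) tS.
  rewrite /= odd_double /= sv leq_double (allP am) // av; split=> //.
  have e : perm_eq (map double S) (map double (t :: rem t S)).
    by apply: perm_map; exact: perm_to_rem.
  by rewrite (permPr e) /= perm_cons.
have t0 := sorted_gt0 srt tS.
have [||| sv pv av] := IH _ _ _ _ _ vR => //.
  by move: sz; rewrite leq_eqVlt (negbTE sn).
have tm : (t <= m)%N by apply: (allP am); exact: mem_behead.
have ot : odd t.*2.-1 by rewrite -[t]prednK // doubleS /= odd_double.
by rewrite /= ot /= sv av (leq_trans (leq_pred _)) ?leq_double.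
Qed.

(* Triples (lo, t, hi), where [lo, hi] is the component of t in [0, m] once the
   open edges on the left of all marked points but the first are removed. *)
Fixpoint gaps (m lo s : nat) (S : seq nat) : seq (nat * nat * nat) :=
  if S is s' :: S' then (lo, s, s'.-1) :: gaps m s' s' S' else [:: (lo, s, m)].

Lemma gaps_wf m lo s S : path ltn s S -> (lo <= s)%N -> all (fun s => s <= m)%N (s :: S) ->
  [/\ [seq g.1.2 | g <- gaps m lo s S] = s :: S,
     all (fun g => (lo <= g.1.1 <= g.1.2) && (g.1.2 <= g.2 <= m))%N (gaps m lo s S) &
     pairwise (fun g h => g.2 < h.1.1)%N (gaps m lo s S)].
Proof.
elim: S lo s => [|t S IH] lo s /=; first by rewrite !andbT => _ los sm; rewrite !leqnn los sm.
move=> /andP[st pS] los /and3P[sm tm aS].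
have [|e1 e2 e3] := IH t t pS (leqnn _); first by rewrite /= tm.
rewrite e1 leqnn los e3; have [t0 ts] : (0 < t)%N /\ (s <= t.-1)%N by lia.
split=> //.
  rewrite ts (leq_trans (leq_pred t)) //=.
  by apply: sub_all e2 => g /andP[/andP[h1 ->] ->]; rewrite andbT andbT; lia.
rewrite andbT; apply: sub_all e2 => g /andP[/andP[h1 _] _]; lia.
Qed.

Lemma gaps_cover (R : realType) m lo s S (r : R) : lo%:R <= r <= m%:R ->
  path ltn s S -> (lo <= s)%N -> all (fun s => s <= m)%N (s :: S) ->
  (exists2 g, g \in gaps m lo s S & g.1.1%:R <= r <= g.2%:R) \/
  (exists2 t, t \in S & t.-1%:R < r < t%:R).
Proof.
elim: S lo s => [|t S IH] lo s /=; first by move=> rlo *; left; exists (lo, s, m); rewrite ?mem_head.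
move=> /andP[lor rm] /andP[st pS] los /and3P[sm tm aS].
have [rt|tr] := leP r t.-1%:R; first by left; exists (lo, s, t.-1); rewrite ?mem_head //= lor.
have [rt|tr'] := ltP r t%:R; first by right; exists t; rewrite ?mem_head // tr.
have [||||[g gG gr]|[u uS ur]] := IH t t => //; first by rewrite tr'.
  by rewrite /= tm.
- by left; exists g; rewrite // inE gG orbT.
- by right; exists u; rewrite // inE uS orbT.
Qed.

Lemma gaps_avoid (R : realType) m lo s S (r : R) g t : path ltn s S -> (lo <= s)%N ->
  all (fun s => s <= m)%N (s :: S) ->
  g \in gaps m lo s S -> g.1.1%:R <= r <= g.2%:R -> t \in S -> ~ (t.-1%:R < r < t%:R).
Proof.
elim: S lo s => [|u S IH] lo s //=.
move=> /andP[su pS] los /and3P[sm um aS]; rewrite inE => /predU1P[-> /=|gG].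
  move=> /andP[_ ru] tuS /andP[tr _]; have : (u <= t)%N.
    move: tuS; rewrite inE => /predU1P[-> //|tS].
    exact/ltnW/(allP (order_path_min ltn_trans pS)).
  move=> ut; have : (u.-1%:R : R) <= t.-1%:R by rewrite ler_nat; lia.
  by move=> h; have := lt_le_trans tr ru; rewrite ltNge h.
move=> gr; rewrite inE => /predU1P[->|]; last by apply: (IH u u) => //=; rewrite um.
have [|_ h _] := gaps_wf (m := m) pS (leqnn u); first by rewrite /= um.
have /andP[/andP[ug _] _] := allP h _ gG.
move: gr => /andP[gr _] /andP[_]; rewrite ltNge => /negP; apply.
by apply: le_trans gr; rewrite ler_nat.
Qed.

End Combinatorics.

(** * The interval model and its recursion on the number of coordinates *)

Section IntervalModel.
Variables (R : realType) (m : nat).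

(** The right end [m] is not tied to [S], because the recursion deletes marked points but keeps the
    interval. *)
Definition hitting n (S : seq nat) : set 'rV[R]_n :=
  [set x | (forall i, 0 <= x 0 i <= m%:R) /\ forall s, s \in S -> exists i, x 0 i = s%:R].

Lemma hitting_S n S x : uniq S -> hitting S x <-> 0 <= row_head x <= m%:R /\
  (hitting S (row_tail x) \/ exists t, [/\ t \in S, row_head x = t%:R & @hitting n (rem t S) (row_tail x)]).
Proof.
move=> uS; rewrite /hitting /= forall_ord_recl; split.
  move=> [[x0 xJ] xS]; split=> //.
  have xJ' i : 0 <= row_tail x 0 i <= m%:R by rewrite mxE.
  have [[t [tS xt]]|nx] := pselect (exists t, t \in S /\ row_head x = t%:R).
    right; exists t; split=> //; split=> // s; rewrite mem_rem_uniq // inE => /andP[st sS].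
    have /exists_ord_recl[x0s|[i xi]] := xS _ sS; last by exists i; rewrite mxE.
    by move/eqP: st; case; apply/eqP; rewrite -(eqr_nat R) -xt -x0s.
  left; split=> // s sS; have /exists_ord_recl[x0s|[i xi]] := xS _ sS.
    by case: nx; exists s.
  by exists i; rewrite mxE.
move=> [x0 [[xJ xS]|[t [tS xt [xJ xS]]]]]; split.
- by split=> // i; have := xJ i; rewrite mxE.
- by move=> s /xS[i]; rewrite mxE => xi; exists (lift 0 i).
- by split=> // i; have := xJ i; rewrite mxE.
- move=> s sS; have [->|st] := eqVneq s t; first by exists 0.
  have /xS[i] : s \in rem t S by rewrite mem_rem_uniq // inE st.
  by rewrite mxE => xi; exists (lift 0 i).
Qed.

Lemma hitting_sub n S S' : {subset S' <= S} -> hitting S `<=` @hitting n S'.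
Proof. by move=> SS x [xJ xS]; split=> // s /SS/xS. Qed.

(** This makes [AE_capped_cylinder] applicable, where the hitting set itself is not known to be an
    extensor. The boxes follow [hitting_S]: the whole interval as first side over [S], a single
    integer over [rem t S]. *)
Lemma hitting_boxes n S : uniq S -> all (fun s => s <= m)%N S ->
  exists bs : seq ('rV[R]_n * 'rV[R]_n), hitting S = boxes bs.
Proof.
elim: n S => [|n IH] S uS aS.
  case: S uS aS => [|s S] _ _.
    exists [:: (0, 0)]; rewrite boxes_cons boxes0 setU0.
    by apply/seteqP; split=> x _; [move=> []|split=> [[]|]].
  exists [::]; rewrite boxes0; apply/seteqP; split=> x //= [_ /(_ s)].
  by rewrite mem_head => /(_ isT)[[]].
pose ext (a b : R) (c : 'rV[R]_n * 'rV[R]_n) := (row_cons a c.1, row_cons b c.2).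
have extE a b bs : boxes (map (ext a b) bs) = head_tail_set [set r | a <= r <= b] (boxes bs).
  elim: bs => [|c bs IHb]; first by rewrite !boxes0; apply/seteqP; split=> x // -[].
  rewrite /= !boxes_cons IHb; apply/seteqP; split=> x.
    move=> [/forall_ord_recl[]|[h1 h2]]; last by split=> //; right.
    rewrite /ext /= -!/(row_head _) !row_head_cons => h1 h2; split => //; left => i.
    by have := h2 i; rewrite !mxE !liftK.
  move=> [h1 [h2|h2]]; [left|by right].
  apply/forall_ord_recl; rewrite /= -!/(row_head _) !row_head_cons; split=> // i.
  by have := h2 i; rewrite !mxE !liftK.
have [bs0 bs0E] := IH _ uS aS.
have bsT t : exists bs : seq ('rV[R]_n * 'rV[R]_n), hitting (rem t S) = boxes bs.
  by apply: IH; [exact: rem_uniq|apply/allP => x /mem_rem/(allP aS)].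
have [bs1 bs1E] : exists bs : seq ('rV[R]_n.+1 * 'rV[R]_n.+1),
    [set x | exists t, [/\ t \in S, row_head x = t%:R & @hitting n (rem t S) (row_tail x)]] = boxes bs.
  elim: {1}S => [|t T [bs bsE]]; first by exists [::]; rewrite boxes0; apply/seteqP; split=> x // -[? []].
  have [cs csE] := bsT t.
  exists (map (ext t%:R t%:R) cs ++ bs); rewrite boxes_cat -bsE extE -csE.
  apply/seteqP; split=> x.
    move=> [u []]; rewrite inE => /predU1P[-> xt xx|uT xu xx]; [left|right; by exists u].
    by split=> //=; rewrite xt lexx.
  move=> [[/= xt xx]|[u [uT xu xx]]]; last by exists u; rewrite inE uT orbT.
  by exists t; rewrite mem_head; split=> //; apply/le_anti; rewrite andbC.
exists (map (ext 0 m%:R) bs0 ++ bs1).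
rewrite boxes_cat extE -bs0E -bs1E; apply/seteqP; split=> x.
  by move/hitting_S => /(_ uS) [x0 [?|?]]; [left|right].
move=> h; apply/hitting_S => //; case: h => [[x0 ?]|[t [tS xt ?]]]; split=> //; first by left.
  by rewrite xt ler0n ler_nat (allP aS).
by right; exists t.
Qed.

Lemma hitting_closed n S : uniq S -> all (fun s => s <= m)%N S -> closed (@hitting n S).
Proof. by move=> uS aS; have [bs ->] := hitting_boxes n uS aS; exact: closed_boxes. Qed.

Lemma hitting_size n S x : uniq S -> @hitting n S x -> (size S <= n)%N.
Proof.
elim: n S x => [|n IH] S x uS.
  by case: S uS => // s S _ [_ /(_ s)]; rewrite mem_head => /(_ isT)[[]].
move=> /hitting_S => /(_ uS)[_ [/IH h|[t [tS _ /IH h]]]]; first by rewrite leqW // h.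
by have := h (rem_uniq _ uS); rewrite size_rem //; case: (S) tS.
Qed.

Lemma hitting_perm n S x : uniq S -> size S = n -> @hitting n S x ->
  exists2 p, perm_eq p S & forall i, x 0 i = (nth 0%N p i)%:R.
Proof.
elim: n S x => [|n IH] S x uS.
  by case: S uS => // _ _ _; exists [::] => // -[].
move=> sS /hitting_S => /(_ uS)[_ [/(hitting_size uS)|[t [tS xt xx]]]]; first by rewrite sS ltnn.
have [|p pS px] := IH _ _ (rem_uniq t uS) _ xx; first by rewrite size_rem // sS.
exists (t :: p); first by rewrite perm_sym (permPl (perm_to_rem tS)) perm_cons perm_sym.
by apply/forall_ord_recl; split=> // i; rewrite /= -px mxE.
Qed.

End IntervalModel.

(** * The complement of the removed open cells is an absolute extensor *)

Section OpenCells.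
Variables (R : realType) (m : nat).
Local Notation hitting := (@hitting R m _).

(** Half of a letter is the centre of its cell: the vertex t for the letter 2t, the midpoint t - 1/2
    of the edge for 2t - 1. *)
Definition ocell (c : nat) (r : R) : Prop :=
  if odd c then is_true (`|r - c%:R / 2| < 1 / 2) else r = c%:R / 2.

Definition ocells n (w : seq nat) (x : 'rV[R]_n) :=
  forall i : 'I_n, ocell (nth 0%N w i) (x 0 i).

(** This is the set X'_n(S) of the overview. *)
Definition hitting_core n (S : seq nat) : set 'rV[R]_n :=
  hitting S `&` [set x | forall w, w \in removed_words n S -> ~ ocells w x].
Arguments hitting_core n S : clear implicits.

Lemma ocell_double t r : ocell t.*2 r <-> r = t%:R.
Proof.
rewrite /ocell odd_double -mul2n natrM (mulrC 2%:R) mulfK //; exact: pnatr_eq0.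
Qed.

Lemma ocell_predn t r : (0 < t)%N -> ocell t.*2.-1 r <-> t.-1%:R < r < t%:R.
Proof.
case: t => // t _; rewrite /ocell doubleS /= odd_double /=.
have -> : (t.*2.+1)%:R / 2 = t%:R + 1 / 2 :> R.
  by rewrite -addn1 natrD -mul2n natrM; lra.
rewrite ltr_norml -(addn1 t) natrD; split=> /andP[h1 h2]; apply/andP; split; lra.
Qed.

Lemma ocell_nat c t : ocell c t%:R -> c = t.*2.
Proof.
rewrite /ocell; case: ifP => oc.
  have -> : c = (c./2.*2).+1 by rewrite -[LHS]odd_double_half oc.
  have -> : ((c./2.*2).+1)%:R / 2 = (c./2)%:R + 1 / 2 :> R.
    by rewrite -addn1 natrD -mul2n natrM; lra.
  move: c./2 => j; rewrite ltr_norml => /andP[h1 h2].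
  have : (j < t)%N by rewrite -(ltr_nat R); lra.
  have : (t < j.+1)%N by rewrite -(ltr_nat R) -(addn1 j) natrD; lra.
  by rewrite ltnS leqNgt => /negP.
move=> tc; have : (t.*2)%:R = c%:R :> R by rewrite -mul2n natrM tc mulrC divfK ?pnatr_eq0.
by move/eqP; rewrite eqr_nat => /eqP.
Qed.

Lemma ocells_cons n c w (x : 'rV[R]_n.+1) :
  ocells (c :: w) x <-> ocell c (row_head x) /\ ocells w (row_tail x).
Proof.
rewrite /ocells forall_ord_recl; split=> -[h1 h2]; split=> // i.
  by have := h2 i; rewrite mxE.
by have := h2 i; rewrite mxE.
Qed.

(** The even letters of a removed word for [rem t S] are the points of [rem t S], once each, and an
    open edge contains no integer. A point of such a cell hence never takes the value [t]. This is
    the dimension argument of the overview. *)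
Lemma hitting_sub_core n S t : sorted ltn S -> all (fun s => s <= m)%N S ->
  (size S <= n.+1)%N -> t \in S -> hitting S `<=` hitting_core n (rem t S).
Proof.
move=> srt aS sS tS x xS; have uS := sorted_uniq ltn_trans ltnn srt.
split; first exact: hitting_sub (@mem_rem _ t S) _ xS.
move=> w wR wx.
have [| || sw pw _] := @removed_words_wf n (rem t S) m w _ _ _ wR.
- exact: (subseq_sorted ltn_trans (rem_subseq _ _)).
- by apply/allP => y /mem_rem/(allP aS).
- by rewrite size_rem // -ltnS prednK //; case: (S) tS.
have [_ /(_ t tS)[i xi]] := xS; have := wx i; rewrite xi => /ocell_nat wi.
have : t.*2 \in evens w by rewrite mem_filter odd_double -wi mem_nth ?sw.
rewrite (perm_mem pw) => /mapP[u uS' /double_inj tu].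
by move: uS'; rewrite -tu mem_rem_uniq // inE eqxx.
Qed.

Lemma hitting_core_full n S : sorted ltn S -> S != [::] -> size S = n -> all (fun s => s <= m)%N S ->
  hitting_core n S = [set \row_i (nth 0%N S i)%:R].
Proof.
move=> srt S0 sS aS; have uS := sorted_uniq ltn_trans ltnn srt.
have rwE : removed_words n S = [seq map double p | p <- permutations S & p != S].
  by case: n sS => [|n] sS /=; [case: (S) S0 sS|rewrite (negbTE S0) sS eqxx].
have wE p (x : 'rV[R]_n) : size p = n -> ocells (map double p) x <-> forall i, x 0 i = (nth 0%N p i)%:R.
  move=> sp; split=> h i; have := h i.
    by rewrite (nth_map 0%N) ?sp ?ltn_ord // => /ocell_double.
  by move=> ?; rewrite (nth_map 0%N) ?sp ?ltn_ord //; apply/ocell_double.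
apply/seteqP; split=> x.
  move=> [xS xR]; have [p pS px] := hitting_perm uS sS xS.
  have [pE|pNS] := eqVneq p S; first by apply/rowP => i; rewrite mxE px pE.
  case: (xR (map double p)); last by apply/wE; rewrite ?(perm_size pS).
  by rewrite rwE map_f // mem_filter pNS mem_permutations.
move=> ->; split.
  split=> [i|s sS']; first by rewrite mxE ler0n ler_nat (allP aS) // mem_nth ?sS.
  have si : (index s S < n)%N by rewrite -sS index_mem.
  by exists (Ordinal si); rewrite mxE /= nth_index.
rewrite rwE => w /mapP[p]; rewrite mem_filter mem_permutations => /andP[pNS pS] ->.
have sp : size p = n by rewrite (perm_size pS).
move=> /(wE _ _ sp) h; move/eqP: pNS; apply; apply: (@eq_from_nth _ 0%N); first by rewrite sp.
move=> i; rewrite sp => ni; have := h (Ordinal ni); rewrite mxE /= => /eqP.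
by rewrite eqr_nat => /eqP.
Qed.

(** The list of gaps is a parameter, so that the pieces can be attached one at a time. *)
Definition core_pieces n (S : seq nat) (L : seq (nat * nat * nat)) : set 'rV[R]_n.+1 :=
  [set x | (0 <= row_head x <= m%:R /\ hitting_core n S (row_tail x)) \/
    exists2 g, g \in L &
      capped_cylinder [set r | g.1.1%:R <= r <= g.2%:R] g.1.2%:R (hitting S) (hitting_core n (rem g.1.2 S)) x].
Arguments core_pieces n S L : clear implicits.

(** A removed cell with a vertex as first letter contains no point whose tail hits all of [S]
    ([noA]), and one with an edge as first letter contains no point over an integer ([noB]). So the
    slice at [t] is affected by the first family only and the cylinder over the hitting set of [S]
    by the second only. *)
Lemma hitting_core_S n s S : sorted ltn (s :: S) -> (size (s :: S) <= n)%N ->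
  all (fun s => s <= m)%N (s :: S) ->
  hitting_core n.+1 (s :: S) = core_pieces n (s :: S) (gaps m 0 s S).
Proof.
move=> srt sS aS; set S' := s :: S; have uS : uniq S' := sorted_uniq ltn_trans ltnn srt.
have rwE : removed_words n.+1 S' = [seq t.*2 :: w | t <- S', w <- removed_words n (rem t S')] ++
                        [seq t.*2.-1 :: w | t <- S, w <- removed_words n S'].
  by rewrite [LHS]/= -/S'; case: eqP => // e; move: sS; rewrite -ltnS -e ltnn.
have [e1 e2 e3] := gaps_wf srt (leq0n s) aS.
have mem_gap t : t \in S' -> exists2 g, g \in gaps m 0 s S & g.1.2 = t.
  by rewrite /S' -e1 => /mapP[g gG ->]; exists g.
have gap_mem g : g \in gaps m 0 s S -> g.1.2 \in S' by rewrite /S' -e1; exact: map_f.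
have noA t w (x : 'rV[R]_n.+1) : t \in S' -> w \in removed_words n (rem t S') -> hitting S' (row_tail x) -> ~ ocells (t.*2 :: w) x.
  move=> tS wR xS; have [_ h] := hitting_sub_core srt aS (leqW sS) tS xS; move=> /ocells_cons[_].
  exact: h.
have noB t u w (x : 'rV[R]_n.+1) : t \in S -> u%:R = row_head x -> ~ ocells (t.*2.-1 :: w) x.
  move=> tS ux /ocells_cons[]; rewrite -ux.
  move/(ocell_predn _ (sorted_gt0 srt tS)); rewrite !ltr_nat => /andP[h1 h2] _.
  by lia.
apply/seteqP; split=> x.
  move=> [/hitting_S xX xR]; have [xJ xS] := xX uS.
  have [[t [tS xt xx]]|nA] := pselect (exists t, [/\ t \in S', row_head x = t%:R & hitting (rem t S') (row_tail x)]).
    have [g gG gt] := mem_gap _ tS; right; exists g => //; right; split; rewrite gt //.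
    split=> // w wR wx; apply: (xR (t.*2 :: w)).
      by rewrite rwE mem_cat; apply/orP; left; apply/allpairsPdep; exists t, w.
    by apply/ocells_cons; split=> //; apply/ocell_double.
  case: xS => [xS|//].
  have [xP|nP] := pselect (hitting_core n S' (row_tail x)); first by left.
  (* The tail now lies in a removed cell for [S'], so that the first coordinate has to avoid all
     removed edges and belongs to a gap. *)
  have [w [wR wx]] : exists w, w \in removed_words n S' /\ ocells w (row_tail x).
    by apply: contrapT => h; apply: nP; split=> // w wR wx; apply: h; exists w.
  have [[g gG gx]|[t tS tx]] := @gaps_cover R m 0 s S _ xJ srt (leq0n s) aS.
    by right; exists g => //; left.
  case: (xR (t.*2.-1 :: w)).
    by rewrite rwE mem_cat; apply/orP; right; apply/allpairsPdep; exists t, w.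
  by apply/ocells_cons; split=> //; apply/ocell_predn => //; exact: sorted_gt0 srt tS.
move=> [[xJ xP]|[g gG [[gx xS]|[/= xg xP]]]].
- split; first by apply/hitting_S => //; split=> //; left; case: xP.
  move=> w; rewrite rwE mem_cat => /orP[/allpairsPdep[t [v [tS vR ->]]]|/allpairsPdep[t [v [tS vR ->]]]].
    by apply: noA => //; case: xP.
  by move=> /ocells_cons[_]; case: xP => _; apply.
- have xJ : 0 <= row_head x <= m%:R.
    have /andP[/andP[_ _] /andP[_ gm]] := allP e2 _ gG.
    by case/andP: gx => g1 g2; rewrite (le_trans _ g1) ?ler0n //= (le_trans g2) // ler_nat.
  split; first by apply/hitting_S => //; split=> //; left.
  move=> w; rewrite rwE mem_cat => /orP[/allpairsPdep[t [v [tS vR ->]]]|/allpairsPdep[t [v [tS vR ->]]]].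
    exact: noA.
  move=> /ocells_cons[/(ocell_predn _ (sorted_gt0 srt tS)) + _].
  exact: gaps_avoid srt (leq0n s) aS gG gx tS.
- have gS := gap_mem _ gG; split.
    apply/hitting_S => //; split; first by rewrite xg ler0n ler_nat (allP aS).
    by right; exists g.1.2; split=> //; case: xP.
  move=> w; rewrite rwE mem_cat => /orP[/allpairsPdep[t [v [tS vR ->]]]|/allpairsPdep[t [v [tS vR ->]]]].
    move=> /ocells_cons[/ocell_double]; rewrite xg => /eqP; rewrite eqr_nat => /eqP gt.
    by case: xP => _ h /h; apply; rewrite gt.
  by apply: (noB _ g.1.2).
Qed.

Lemma AE_core_pieces n S L : sorted ltn S -> all (fun s => s <= m)%N S -> (size S <= n)%N ->
  all (fun g => [&& g.1.2 \in S, g.1.1 <= g.1.2 & g.1.2 <= g.2 <= m])%N L ->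
  pairwise (fun g h => g.2 < h.1.1)%N L ->
  closed (hitting_core n S) -> absolute_extensor R (hitting_core n S) ->
  (forall t, t \in S -> closed (hitting_core n (rem t S)) /\ absolute_extensor R (hitting_core n (rem t S))) ->
  closed (core_pieces n S L) /\ absolute_extensor R (core_pieces n S L).
Proof.
move=> srt aS sS aL pL cP aP h; have uS := sorted_uniq ltn_trans ltnn srt.
have U0 : core_pieces n S [::] = head_tail_set [set r | 0 <= r <= m%:R] (hitting_core n S).
  by apply/seteqP; split=> x; [case=> // -[]|left].
have UC g L' : core_pieces n S (g :: L') = core_pieces n S L' `|`
    capped_cylinder [set r | g.1.1%:R <= r <= g.2%:R] g.1.2%:R (hitting S) (hitting_core n (rem g.1.2 S)).
  apply/seteqP; split=> x.
    move=> [x1|[k]]; first by left; left.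
    by rewrite inE => /predU1P[->|kL] kx; [right|left; right; exists k].
  move=> [[?|[k kL kx]]|gx]; [by left|right; exists k|right; exists g]; rewrite ?mem_head //.
  by rewrite inE kL orbT.
elim: L aL pL => [|g L IH] /=.
  by rewrite U0; split; [exact: closed_head_tail_set (@closed_itv _ _ _) cP|apply: AE_head_tail_set => //; exact: AE_itv].
move=> /andP[/and3P[gS lg /andP[gu um]] aL] /andP[gL /(IH aL)[cU aU]] {IH}.
have [cT aT] := h _ gS; have XT := hitting_sub_core srt aS (leqW sS) gS.
have Gt : [set r : R | g.1.1%:R <= r <= g.2%:R] g.1.2%:R.
  by rewrite /= !ler_nat lg.
have cG := @closed_itv R g.1.1%:R g.2%:R.
have aG : absolute_extensor R [set r : R | g.1.1%:R <= r <= g.2%:R].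
  by apply: AE_itv; rewrite ler_nat (leq_trans lg).
have cX := @hitting_closed R m n S uS aS.
rewrite UC; split; first by apply: closedU => //; exact: closed_capped_cylinder.
apply: AE_glue => //; first exact: closed_capped_cylinder.
  by have [bs bsE] := hitting_boxes R n uS aS; rewrite bsE in XT *; exact: AE_capped_cylinder.
(* As the gaps are disjoint, the new piece meets the earlier ones only inside the cylinder over the
   core. *)
rewrite (_ : _ `&` _ = head_tail_set [set r | g.1.1%:R <= r <= g.2%:R] (hitting_core n S)); first exact: AE_head_tail_set.
apply/seteqP; split=> x.
  move=> [[[xJ xP]|[k kL kx]] gx].
    by case: gx => [[? _]|[/= xg _]]; split=> //; rewrite xg.
  have gx' : g.1.1%:R <= row_head x <= g.2%:R by case: gx => [[]|[/= ->]].
  have kx' : k.1.1%:R <= row_head x <= k.2%:R.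
    by case: kx => [[]|[/= -> _]] //; rewrite !ler_nat; have /and3P[_ -> /andP[]] := allP aL _ kL.
  have := allP gL _ kL; rewrite -(ltr_nat R).
  by case/andP: gx' => _ x1; case/andP: kx' => x2 _ /lt_le_trans /(_ x2) gx2; have := le_lt_trans x1 gx2; rewrite ltxx.
move=> [/= gx xP]; split; last by left; split=> //; case: xP.
left; split=> //; case/andP: gx => g1 g2; rewrite (le_trans _ g1) ?ler0n //=.
by rewrite (le_trans g2) // ler_nat.
Qed.

Lemma AE_hitting_core n S : sorted ltn S -> all (fun s => s <= m)%N S -> (size S <= n)%N ->
  closed (hitting_core n S) /\ absolute_extensor R (hitting_core n S).
Proof.
elim: n S => [|n IH] S srt aS sS; have [S0|S0] := eqVneq S [::].
- have -> : hitting_core 0 S = [set 0].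
    rewrite S0; apply/seteqP; split=> x /=; first by move=> _; apply/rowP => -[].
    by move=> _; split=> //; split=> // -[].
  by split; [exact: closed_row1|exact: AE_set1].
- by case: (S) S0 sS.
- have -> : hitting_core n.+1 S = [set x | forall i : 'I_n.+1, [set r | 0 <= r <= m%:R] (x 0 i)].
    by rewrite S0; apply/seteqP; split=> x /=; [case=> -[]|].
  split; last by apply: (AE_rows (A := fun=> [set r | 0 <= r <= m%:R])) => i; apply: AE_itv.
  rewrite [X in closed X](_ : _ = box (const_mx 0, const_mx m%:R)); first exact: closed_box.
  by apply/seteqP; split=> x h i; have := h i; rewrite /= !mxE.
have [sn|/eqP sn] := eqVneq (size S) n.+1.
  by rewrite hitting_core_full //; split; [exact: closed_row1|exact: AE_set1].
have {}sn : (size S <= n)%N by move: sS; rewrite leq_eqVlt => /predU1P[].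
case: S srt aS S0 sn {sS} => // s S srt aS _ sS; rewrite hitting_core_S //.
have [e1 e2 e3] := gaps_wf srt (leq0n s) aS.
have [cP aP] := IH _ srt aS sS.
apply: AE_core_pieces => //.
  apply/allP => g gG; have /andP[/andP[_ ->] ->] := allP e2 _ gG.
  by rewrite !andbT -e1; exact: (map_f (fun g => g.1.2)).
move=> t tS; apply: IH.
- exact: (subseq_sorted ltn_trans (rem_subseq _ _)).
- by apply/allP => x /mem_rem/(allP aS).
- by rewrite size_rem // (leq_trans (leq_pred _)).
Qed.

End OpenCells.

(** * Gluing of finite families, maps into subspaces, and descent to compact quotients *)

Section Gluing.
Implicit Types X Y Z : topologicalType.

Lemma continuous_on_bigcup (I : finType) X Y (A : I -> set X) (f : X -> Y) :
  (forall i, continuous_on (A i) f) -> continuous_on (\bigcup_i A i) f.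
Proof.
move=> cf C cC; rewrite setI_bigcupl; apply: closed_bigcup; first exact: finite_finset.
by move=> i _; exact: cf.
Qed.

Lemma glue_family (I : finType) X Y (A : I -> set X) (f : I -> X -> Y) (y0 : Y) :
  (forall i, continuous_on (A i) (f i)) ->
  (forall i j x, A i x -> A j x -> f i x = f j x) ->
  exists2 g : X -> Y, continuous_on (\bigcup_i A i) g & forall i x, A i x -> g x = f i x.
Proof.
move=> cf ff.
have /choice[g gP] : forall x, exists y, forall i, A i x -> y = f i x.
  move=> x; have [[i Aix]|nA] := pselect (exists i, A i x).
    by exists (f i x) => j; exact: ff.
  by exists y0 => i Aix; case: nA; exists i.
exists g; last by move=> i x; exact: gP.
by apply: continuous_on_bigcup => i; apply: continuous_on_eq (cf i) => x /set_mem /gP ->.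
Qed.

Lemma continuous_on_into_subtype X Y (A : set X) (B : set Y) (f : X -> B) :
  continuous_on A (fun x => set_val (f x)) -> continuous_on A f.
Proof.
move=> cf C cC; have [D cD <-] : exists2 D : set Y, closed D & set_val @^-1` D = C.
  have : open (~` C) by rewrite openC.
  case=> D oD DC; exists (~` D); first exact: open_closedC.
  by rewrite -[RHS]setCK -DC.
exact: cf.
Qed.

Lemma continuous_into_subtype X Y (B : set Y) (f : X -> B) :
  continuous (fun x => set_val (f x)) -> continuous f.
Proof.
move=> cf; apply: continuous_onT; apply: continuous_on_into_subtype.
by apply: continuous_onW => //; exact: closedT.
Qed.

Lemma continuous_val X (B : set X) : continuous (@set_val X B).
Proof. exact: initial_continuous. Qed.

(** A continuous map from a compact set to a Hausdorff space is closed, hence a quotient map onto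
    its image. *)
Lemma compact_descent X Y Z (A : set X) (q : X -> Y) (h : X -> Z) (k : Y -> Z) :
  compact A -> hausdorff_space Y -> continuous_on A q -> continuous_on A h ->
  (forall x, A x -> k (q x) = h x) -> continuous_on (q @` A) k.
Proof.
move=> cA hY cq ch kq C cC.
have -> : q @` A `&` k @^-1` C = q @` (A `&` h @^-1` C).
  apply/seteqP; split=> y.
    by move=> [[x Ax <-]]; rewrite /= kq // => Cx; exists x.
  by move=> [x [Ax Cx] <-]; split; [exists x|rewrite /= kq].
have cAC := ch C cC; apply: compact_closed => //; apply: continuous_compact.
  by apply/continuous_on_within => //; apply: continuous_onS cq => // x [].
by apply: (subclosed_compact _ cA) => // x [].
Qed.

Lemma cluster_image X Y (f : X -> Y) x y : continuous f -> hausdorff_space Y ->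
  cluster (nbhs x) y -> f x = f y.
Proof.
move=> cf hY xy; apply: hY => U V /cf nU /cf nV.
by have [z [Uz Vz]] := xy _ _ nU nV; exists (f z).
Qed.

Lemma hausdorff_pair X Y : hausdorff_space X -> hausdorff_space Y -> hausdorff_space (X * Y)%type.
Proof.
move=> hX hY [x y] [x' y'] xy; congr pair.
  by apply: (@cluster_image _ _ fst _ _ _ hX xy) => z; exact: cvg_fst.
by apply: (@cluster_image _ _ snd _ _ _ hY xy) => z; exact: cvg_snd.
Qed.

Lemma hausdorff_subtype X (B : set X) : hausdorff_space X -> hausdorff_space B.
Proof.
move=> hX x y xy; apply/val_inj.
exact: (cluster_image (@continuous_val X B) hX xy).
Qed.

End Gluing.

(** * Homotopy equivalences *)

Section HomotopyEquivalence.
Variable R : realType.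
Implicit Types X Y Z W : topologicalType.

(* Unlike [homotopic], the homotopy is continuous for all times, which
   costs nothing as time can be clamped to the unit interval. *)
Definition homot X Y (f g : X -> Y) := exists H : X * R -> Y,
  [/\ continuous H, forall x, H (x, 0) = f x & forall x, H (x, 1) = g x].

Lemma homot_homotopic X Y (f g : X -> Y) : homot f g -> homotopic R f g.
Proof. by move=> [H [cH H0 H1]]; exists H; split=> //; exact: continuous_subspaceT. Qed.

Lemma continuous_pair X Y Z (f : X -> Y) (g : X -> Z) :
  continuous f -> continuous g -> continuous (fun x => (f x, g x)).
Proof. by move=> cf cg x; apply: cvg_pair; [exact: cf|exact: cg]. Qed.

Lemma continuous_compose X Y Z (f : X -> Y) (g : Y -> Z) :
  continuous f -> continuous g -> continuous (g \o f).
Proof. by move=> cf cg x; apply: continuous_comp; [exact: cf|exact: cg]. Qed.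

Lemma homot_sym X Y (f g : X -> Y) : homot f g -> homot g f.
Proof.
move=> [H [cH H0 H1]]; exists (H \o (fun xt => (xt.1, 1 - xt.2))); split.
- apply: continuous_compose => //; apply: continuous_pair; first by move=> xt; exact: cvg_fst.
  move=> xt; apply: cvgB; [exact: cvg_cst|exact: cvg_snd].
- by move=> x; rewrite /= subr0.
- by move=> x; rewrite /= subrr.
Qed.

Lemma homot_comp X Y Z W (f g : X -> Y) (h : Y -> Z) (k : W -> X) :
  continuous h -> continuous k -> homot f g -> homot (h \o f \o k) (h \o g \o k).
Proof.
move=> ch ck [H [cH H0 H1]]; exists (h \o H \o (fun xt => (k xt.1, xt.2))); split.
- apply: continuous_compose; last exact: continuous_compose.
  apply: continuous_pair; last by move=> xt; exact: cvg_snd.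
  by apply: (@continuous_compose (W * R)%type W X (fun xt => xt.1) k) => // xt; exact: cvg_fst.
- by move=> x; rewrite /= H0.
- by move=> x; rewrite /= H1.
Qed.

Lemma homot_trans X Y (f g h : X -> Y) : homot f g -> homot g h -> homot f h.
Proof.
move=> [H [cH H0 H1]] [K [cK K0 K1]].
pose A := [set xt : X * R | xt.2 <= 1 / 2]; pose B := [set xt : X * R | 1 / 2 <= xt.2].
have csnd : continuous (@snd X R) by move=> xt; exact: cvg_snd.
have cA : closed A.
  by move/continuous_closedP : csnd => /(_ _ (@closed_le _ (1 / 2))).
have cB : closed B.
  by move/continuous_closedP : csnd => /(_ _ (@closed_ge _ (1 / 2))).
pose H' := H \o (fun xt : X * R => (xt.1, clamp 0 1 (2 * xt.2))).
pose K' := K \o (fun xt : X * R => (xt.1, clamp 0 1 (2 * xt.2 - 1))).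
have cH' : continuous H'.
  apply: continuous_compose => //; apply: continuous_pair; first by move=> xt; exact: cvg_fst.
  apply: (@continuous_compose _ _ _ (fun xt : X * R => 2 * xt.2) (clamp 0 1)); last exact: clamp_continuous.
  by move=> xt; apply: cvgM; [exact: cvg_cst|exact: cvg_snd].
have cK' : continuous K'.
  apply: continuous_compose => //; apply: continuous_pair; first by move=> xt; exact: cvg_fst.
  apply: (@continuous_compose _ _ _ (fun xt : X * R => 2 * xt.2 - 1) (clamp 0 1)); last exact: clamp_continuous.
  move=> xt; apply: cvgB; last exact: cvg_cst.
  by apply: cvgM; [exact: cvg_cst|exact: cvg_snd].
have c0 (t : R) : t <= 0 -> clamp 0 1 t = 0.
  by move=> t0; rewrite /clamp min_r ?max_l // (le_trans t0).
have c1 (t : R) : 1 <= t -> clamp 0 1 t = 1.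
  by move=> t1; rewrite /clamp min_l ?max_r.
have HK xt : A xt -> B xt -> H' xt = K' xt.
  rewrite /A /B /= => h1 h2; have t2 : xt.2 = 1 / 2 by apply/le_anti/andP.
  rewrite /H' /K' /= t2 c1; last by lra.
  by rewrite c0 ?H1 ?K0 //; lra.
exists (glue A H' K'); split.
- apply: continuous_onT; have -> : [set: X * R] = A `|` B.
    by apply/seteqP; split=> // xt _; case: (leP xt.2 (1 / 2)) => [|/ltW]; [left|right].
  by apply: continuous_on_glue => //; exact: continuous_onW.
- by move=> x; rewrite glue_in /A /= ?divr_ge0 // /H' /= c0 ?mulr0.
- move=> x; rewrite glue_notin; last by rewrite /A /= => le1; lra.
  by rewrite /K' /= c1 ?K1 //; lra.
Qed.

Definition hequiv X Y := exists (f : X -> Y) (g : Y -> X),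
  [/\ continuous f, continuous g, homot (g \o f) idfun & homot (f \o g) idfun].

Lemma hequiv_homotopy_equivalent X Y : hequiv X Y -> homotopy_equivalent R X Y.
Proof.
by move=> [f [g [cf cg gf fg]]]; exists f, g; split=> //; exact: homot_homotopic.
Qed.

Lemma hequiv_trans X Y Z : hequiv X Y -> hequiv Y Z -> hequiv X Z.
Proof.
move=> [f [g [cf cg gf fg]]] [h [k [ch ck kh hk]]].
exists (h \o f), (g \o k); split; [exact: continuous_compose|exact: continuous_compose| |].
  by apply: homot_trans gf; exact: (homot_comp cg cf kh).
by apply: homot_trans hk; exact: (homot_comp ch ck fg).
Qed.

End HomotopyEquivalence.

(** * Continuity of the pointwise operations *)

Section ContinuousOperations.
Variables (R : realType) (T : topologicalType).

Lemma continuous_add (V : normedModType R) (f g : T -> V) :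
  continuous f -> continuous g -> continuous (fun x => f x + g x).
Proof. by move=> cf cg x; apply: cvgD; [exact: cf|exact: cg]. Qed.

Lemma continuous_sub (V : normedModType R) (f g : T -> V) :
  continuous f -> continuous g -> continuous (fun x => f x - g x).
Proof. by move=> cf cg x; apply: cvgB; [exact: cf|exact: cg]. Qed.

Lemma continuous_scale (V : normedModType R) (f : T -> R) (g : T -> V) :
  continuous f -> continuous g -> continuous (fun x => f x *: g x).
Proof. by move=> cf cg x; apply: cvgZ; [exact: cf|exact: cg]. Qed.

Lemma continuous_mul (f g : T -> R) :
  continuous f -> continuous g -> continuous (fun x => f x * g x).
Proof. by move=> cf cg x; apply: cvgM; [exact: cf|exact: cg]. Qed.

Lemma continuous_normr (V : normedModType R) (f : T -> V) :
  continuous f -> continuous (fun x => `|f x|).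
Proof. by move=> cf x; apply: cvg_norm; exact: cf. Qed.

Lemma continuous_inv (f : T -> R) :
  (forall x, f x != 0) -> continuous f -> continuous (fun x => (f x)^-1).
Proof. by move=> f0 cf x; apply: cvgV => //; exact: cf. Qed.

Lemma continuous_sum (I : finType) (f : I -> T -> R) :
  (forall i, continuous (f i)) -> continuous (fun x => \sum_i f i x).
Proof.
move=> cf; elim: (index_enum I) => [|i s IH].
  by under eq_fun do rewrite big_nil; exact: cst_continuous.
under eq_fun do rewrite big_cons.
by apply: (@continuous_add R^o) => //; exact: cf.
Qed.

End ContinuousOperations.

(** * The sphere as a cube with its boundary crushed to a point *)

Section SphereAsCubeQuotient.
Variables (R : realType).

Lemma norm_row_le n (y : 'rV[R]_n) (r : R) : 0 <= r ->
  `|y| <= r <-> forall j, `|y 0 j| <= r.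
Proof.
move=> r0; rewrite [X in X <= r]mx_normrE; split.
  by move=> /bigmax_leP[_ h] j; exact: (h (0, j)).
by move=> h; apply/bigmax_leP; split=> // -[i j] _ /=; rewrite ord1.
Qed.

Lemma norm_row_entry n (y : 'rV[R]_n) j : `|y 0 j| <= `|y|.
Proof. by move: j; apply/norm_row_le. Qed.

Variable d : nat.
Implicit Types y : 'rV[R]_d.

Definition sqnorm y : R := \sum_j y 0 j ^+ 2.

Lemma sqnorm_ge0 y : 0 <= sqnorm y.
Proof. by apply: sumr_ge0 => j _; exact: sqr_ge0. Qed.

Lemma sqnorm_eq0 y : sqnorm y = 0 -> y = 0.
Proof.
move=> /eqP; rewrite psumr_eq0 => [/allP h|j _]; last exact: sqr_ge0.
by apply/rowP => j; have := h j; rewrite mem_index_enum sqrf_eq0 mxE => /(_ isT)/eqP.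
Qed.

Lemma sqnormZ (a : R) y : sqnorm (a *: y) = a ^+ 2 * sqnorm y.
Proof. by rewrite /sqnorm mulr_sumr; apply: eq_bigr => j _; rewrite mxE exprMn. Qed.

(* Inverse stereographic projection of y / (1 - |y|), extended to the unit
   sphere of the sup norm, which it sends to the projection centre. *)
Definition cube_sphere y : 'rV[R]_d.+1 :=
  let b := 1 - `|y| in let s := sqnorm y + b ^+ 2 in
  row_cons ((sqnorm y - b ^+ 2) / s) ((2 * b / s) *: y).

Lemma cube_sphere_den y : 0 < sqnorm y + (1 - `|y|) ^+ 2.
Proof.
have [y0|y0] := eqVneq (sqnorm y) 0.
  by rewrite y0 add0r (sqnorm_eq0 y0) normr0 subr0 expr1n ltr01.
by rewrite ltr_wpDr ?sqr_ge0 // lt_neqAle eq_sym y0 sqnorm_ge0.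
Qed.

Lemma sphere_cns (a : R) y : sphere R d (row_cons a y) <-> a ^+ 2 + sqnorm y = 1.
Proof.
rewrite /sphere /= big_ord_recl -/(row_head _) row_head_cons.
rewrite (_ : \sum_i _ = sqnorm y) //; apply: eq_bigr => j _.
by rewrite -[in RHS](row_tail_cons a y) [in RHS]mxE.
Qed.

Lemma cube_sphereP y : sphere R d (cube_sphere y).
Proof.
apply/sphere_cns; rewrite sqnormZ; have := cube_sphere_den y.
move: (sqnorm y) (1 - `|y|) => s b s0; field; exact: lt0r_neq0.
Qed.

Lemma delta_cns : delta_mx 0 0 = row_cons 1 0 :> 'rV[R]_d.+1.
Proof.
apply/rowP; apply/forall_ord_recl; split=> [|j].
  by rewrite -/(row_head (row_cons _ _)) row_head_cons mxE !eqxx.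
by rewrite !mxE liftK mxE eqxx.
Qed.

Lemma row_cons_inj (a a' : R) n (y y' : 'rV[R]_n) : row_cons a y = row_cons a' y' -> a = a' /\ y = y'.
Proof.
move=> e; split; first by have := row_head_cons a y; rewrite e row_head_cons.
by have := row_tail_cons a y; rewrite e row_tail_cons.
Qed.

Lemma cube_sphere_bd y : cube_sphere y = delta_mx 0 0 <-> `|y| = 1.
Proof.
rewrite delta_cns /cube_sphere; split.
  move=> /row_cons_inj[/eqP h _]; move: h (cube_sphere_den y).
  move: (sqnorm y) (`|y|) => s b h s0; move: h.
  rewrite -subr_eq0 => /eqP h.
  have : (s - (1 - b) ^+ 2) / (s + (1 - b) ^+ 2) - 1 = - 2 * (1 - b) ^+ 2 / (s + (1 - b) ^+ 2).
    by field; exact: lt0r_neq0.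
  rewrite h => /esym/eqP; rewrite mulf_eq0 invr_eq0 (gt_eqF s0) orbF mulf_eq0 oppr_eq0 pnatr_eq0 /=.
  by rewrite sqrf_eq0 subr_eq0 => /eqP ->.
move=> y1; have := cube_sphere_den y; rewrite y1 subrr expr0n /= addr0 subr0 => s0.
by rewrite mulr0 mul0r scale0r divff // lt0r_neq0.
Qed.

(** The first coordinate determines the square of 1 - |y| over the denominator. With this the other
    coordinates determine the vector y / (1 - |y|), and its norm gives back |y|. *)
Lemma cube_sphere_inj y y' : `|y| < 1 -> `|y'| < 1 -> cube_sphere y = cube_sphere y' -> y = y'.
Proof.
move=> y1 y1' /row_cons_inj[].
have := cube_sphere_den y; have := cube_sphere_den y'.
set s := sqnorm y + _; set s' := sqnorm y' + _ => s0' s0 h1 h2.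
have b0 : 0 < 1 - `|y| by rewrite subr_gt0.
have b0' : 0 < 1 - `|y'| by rewrite subr_gt0.
have e1 : (1 - `|y|) ^+ 2 / s = (1 - `|y'|) ^+ 2 / s'.
  have e : (sqnorm y - (1 - `|y|) ^+ 2) / s = 1 - 2 * ((1 - `|y|) ^+ 2 / s).
    by rewrite -[1](@divff _ s) ?lt0r_neq0 // /s; field; exact: lt0r_neq0.
  have e' : (sqnorm y' - (1 - `|y'|) ^+ 2) / s' = 1 - 2 * ((1 - `|y'|) ^+ 2 / s').
    by rewrite -[1](@divff _ s') ?lt0r_neq0 // /s'; field; exact: lt0r_neq0.
  by move: h1; rewrite e e'; lra.
have e2 : (1 - `|y'|) *: y = (1 - `|y|) *: y'.
  have k0 : 2 * ((1 - `|y|) ^+ 2 / s) != 0 by rewrite lt0r_neq0 // mulr_gt0 // divr_gt0 ?exprn_gt0.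
  apply: (scalerI k0); rewrite !scalerA.
  have -> : 2 * ((1 - `|y|) ^+ 2 / s) * (1 - `|y'|) = ((1 - `|y|) * (1 - `|y'|)) * (2 * (1 - `|y|) / s).
    by field; exact: lt0r_neq0.
  rewrite -[LHS]scalerA h2 e1 [LHS]scalerA; congr (_ *: _); field; exact: lt0r_neq0.
have : `|(1 - `|y'|) *: y| = `|(1 - `|y|) *: y'| by rewrite e2.
rewrite !normrZ !gtr0_norm // => e3; have e4 : `|y| = `|y'| by nra.
by move: e2; rewrite e4; apply: scalerI; rewrite lt0r_neq0.
Qed.

Lemma cube_sphere_surj (z : 'rV[R]_d.+1) : sphere R d z -> z != delta_mx 0 0 ->
  exists2 y, `|y| < 1 & cube_sphere y = z.
Proof.
rewrite -(row_cons_head_tail z); move: (row_head z) (row_tail z) => a u /sphere_cns au.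
rewrite delta_cns => zN; have a1 : a != 1.
  apply: contra zN => /eqP a1; move: au; rewrite a1 expr1n => h.
  by rewrite (@sqnorm_eq0 u) //; lra.
have al1 : a < 1.
  rewrite lt_neqAle a1 /=; have := sqnorm_ge0 u; nra.
(* The stereographic projection of the given point from (1, 0). *)
pose v := (1 - a)^-1 *: u; have nv : sqnorm v = (1 + a) / (1 - a).
  rewrite /v sqnormZ; have -> : sqnorm u = 1 - a ^+ 2 by rewrite -au; ring.
  by field; rewrite lt0r_neq0 // subr_gt0.
have uv : u = (1 - a) *: v by rewrite /v scalerA divff ?scale1r // lt0r_neq0 // subr_gt0.
rewrite {}uv {au zN} in nv *; move: v nv => v nv.
have m0 := normr_ge0 v; have m1 : 0 < 1 + `|v| by lra.
(* The map v / (1 + |v|) inverts y / (1 - |y|). *)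
exists ((1 + `|v|)^-1 *: v).
  by rewrite normrZ ger0_norm ?invr_ge0 ?ltW // ltr_pdivrMl // mulr1; lra.
rewrite /cube_sphere sqnormZ normrZ ger0_norm ?invr_ge0 ?ltW // nv.
have -> : 1 - (1 + `|v|)^-1 * `|v| = (1 + `|v|)^-1 by field; exact: lt0r_neq0.
have a0 : 1 - a != 0 by rewrite lt0r_neq0 // subr_gt0.
move: (`|v|) m1 => m m1; have m2 : 1 + m != 0 by exact: lt0r_neq0.
congr row_cons.
  by field; rewrite m2 a0 /=; apply/eqP; lra.
rewrite scalerA; congr (_ *: _).
by field; rewrite m2 a0 /=; apply/eqP; lra.
Qed.

Lemma cube_sphere_continuous : continuous cube_sphere.
Proof.
have id_cont : continuous (fun y : 'rV[R]_d => y) by move=> y; exact: cvg_id.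
have n_cont : continuous sqnorm.
  apply: continuous_sum => j.
  under eq_fun do rewrite expr2.
  by apply: continuous_mul; exact: entry_continuous.
have b_cont : continuous (fun y : 'rV[R]_d => 1 - `|y|).
  apply: (@continuous_sub _ _ R^o); first exact: cst_continuous.
  exact: continuous_normr.
have b2_cont : continuous (fun y : 'rV[R]_d => (1 - `|y|) ^+ 2).
  by under eq_fun do rewrite expr2; exact: continuous_mul.
have s_cont : continuous (fun y : 'rV[R]_d => (sqnorm y + (1 - `|y|) ^+ 2)^-1).
  apply: continuous_inv; first by move=> y; exact/lt0r_neq0/cube_sphere_den.
  exact: (@continuous_add _ _ R^o).
apply: continuous_row; apply/forall_ord_recl; split=> [|j].
  rewrite (_ : (fun z => _) = fun y => (sqnorm y - (1 - `|y|) ^+ 2) / (sqnorm y + (1 - `|y|) ^+ 2)).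
    by apply: continuous_mul => //; exact: (@continuous_sub _ _ R^o).
  by apply/funext => y; rewrite -/(row_head _) row_head_cons.
rewrite (_ : (fun z => _) = fun y => 2 * (1 - `|y|) / (sqnorm y + (1 - `|y|) ^+ 2) * y 0 j).
  apply: continuous_mul; last exact: entry_continuous.
  apply: continuous_mul => //; apply: continuous_mul => //; exact: cst_continuous.
by apply/funext => y; rewrite !mxE liftK mxE.
Qed.

Definition to_sphere y : sphere R d := SigSub (mem_set (cube_sphereP y)).

Lemma to_sphere_continuous : continuous to_sphere.
Proof. by apply: continuous_into_subtype; exact: cube_sphere_continuous. Qed.

Lemma to_sphere_bd y : to_sphere y = sphere_base R d <-> `|y| = 1.
Proof.
rewrite -cube_sphere_bd; split=> [/(congr1 val)//|h]; exact/val_inj.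
Qed.

Lemma to_sphere_inj y y' : `|y| < 1 -> `|y'| < 1 -> to_sphere y = to_sphere y' -> y = y'.
Proof. by move=> h h' /(congr1 val); exact: cube_sphere_inj. Qed.

Lemma to_sphere_surj z : z != sphere_base R d -> exists2 y, `|y| < 1 & to_sphere y = z.
Proof.
move=> zN; have [||y y1 yz] := @cube_sphere_surj (val z).
- exact/set_mem/valP.
- by apply: contra zN => /eqP h; apply/eqP/val_inj.
by exists y => //; apply/val_inj.
Qed.

End SphereAsCubeQuotient.

(** * Crushing an extensor whose complement consists of open cubes *)

Section CellAttachment.
Variables (R : realType) (n d N : nat) (X X' : set 'rV[R]_n).
Variables (k : 'I_N -> 'rV[R]_n) (pos : 'I_N -> 'I_d -> 'I_n) (p : 'rV[R]_n).

(** A closed cube of side 1 in the directions [pos i], centred at [k i]. Twice the sup norm of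
    [x - k i] is its radial coordinate, which is 1 exactly on the boundary. *)
Definition cube_cell i : set 'rV[R]_n :=
  [set x | 2 * `|x - k i| <= 1 /\
     forall a, (forall j, pos i j != a) -> x 0 a = k i 0 a].

(** The index [i0] guarantees that there is a cell: the wedge over an empty family has no base point
    to which [X'] could be sent. *)
Hypotheses (pos_inj : forall i, injective (pos i)) (i0 : 'I_N).
Hypotheses (X'_closed : closed X') (X'_AE : absolute_extensor R X') (X'p : X' p) (X_compact : compact X).
Hypotheses (X'X : X' `<=` X) (cell_sub : forall i, cube_cell i `<=` X).
Hypothesis X_cover : forall x, X x -> X' x \/ exists i, cube_cell i x.
Hypothesis cell_core : forall i x, cube_cell i x -> X' x -> 2 * `|x - k i| = 1.
Hypothesis cell_cell : forall i j x, i != j -> cube_cell i x -> cube_cell j x -> 2 * `|x - k i| = 1.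
Hypothesis cell_boundary : forall i x, cube_cell i x -> 2 * `|x - k i| = 1 -> X' x.

Lemma closed_pre (Y Z : topologicalType) (f : Y -> Z) (C : set Z) :
  continuous f -> closed C -> closed (f @^-1` C).
Proof. by move/continuous_closedP; exact. Qed.

Lemma norm_sub_continuous i : continuous (fun x : 'rV[R]_n => 2 * `|x - k i|).
Proof.
apply: continuous_mul; first exact: cst_continuous.
apply: continuous_normr; apply: continuous_sub; last exact: cst_continuous.
by move=> x; exact: cvg_id.
Qed.

Lemma cube_cell_closed i : closed (cube_cell i).
Proof.
apply: closedI; first exact: (closed_pre (@norm_sub_continuous i) (@closed_le _ 1)).
rewrite [X in closed X](_ : _ = \bigcap_(a in [set a | forall j, pos i j != a])
    ((fun x : 'rV[R]_n => x 0 a) @^-1` [set r | k i 0 a <= r <= k i 0 a])).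
  by apply: closed_bigI => a _; apply: closed_pre; [exact: entry_continuous|exact: closed_itv].
apply/seteqP; split=> x h a ha; first by rewrite /= h // lexx.
by have := h a ha; rewrite /= => /andP[h1 h2]; apply/le_anti/andP.
Qed.

Let Z := ('rV[R]_n * R)%type.
Let cfst : continuous (fun z : Z => z.1). Proof. by move=> z; exact: cvg_fst. Qed.
Let csnd : continuous (fun z : Z => z.2). Proof. by move=> z; exact: cvg_snd. Qed.

(** At time t the concentric cube of radial coordinate at most 1 - t / 2 is stretched onto the whole
    cell. Clamping the time keeps the divisor at least 1/2, and the map continuous everywhere. *)
Definition dilate i (z : Z) : 'rV[R]_n :=
  k i + (1 - clamp 0 1 z.2 / 2)^-1 *: (z.1 - k i).

Lemma dilate_continuous i : continuous (dilate i).
Proof.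
apply: continuous_add; first exact: cst_continuous.
apply: continuous_scale; last by apply: continuous_sub => //; exact: cst_continuous.
apply: continuous_inv.
  move=> z; have /andP[_ c1] := @clamp_itv R 0 1 z.2 ler01.
  by apply/eqP => e; lra.
apply: (@continuous_sub _ _ R^o); first exact: cst_continuous.
apply: continuous_mul; last exact: cst_continuous.
exact: (@continuous_compose _ _ _ _ (clamp 0 1) csnd (@clamp_continuous R 0 1)).
Qed.

Lemma dilateE i x t : 0 <= t <= 1 -> dilate i (x, t) = k i + (1 - t / 2)^-1 *: (x - k i).
Proof. by move=> t01; rewrite /dilate clamp_id. Qed.

Lemma norm_dilate i x t : 0 <= t <= 1 ->
  2 * `|dilate i (x, t) - k i| = (1 - t / 2)^-1 * (2 * `|x - k i|).
Proof.
move=> t01; rewrite dilateE // addrAC subrr add0r normrZ ger0_norm; first by rewrite mulrCA.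
by rewrite invr_ge0; case/andP: t01 => *; lra.
Qed.

Lemma dilate_cell i x t : 0 <= t <= 1 -> cube_cell i x -> 2 * `|x - k i| <= 1 - t / 2 ->
  cube_cell i (dilate i (x, t)).
Proof.
move=> t01 [_ xa] xt; have t2 : 0 < 1 - t / 2 by case/andP: t01 => *; lra.
split; first by rewrite norm_dilate // ler_pdivrMl // mulr1.
by move=> a ha; rewrite dilateE // !mxE xa // subrr mulr0 addr0.
Qed.

Lemma dilate0 i x : dilate i (x, 0) = x.
Proof. by rewrite dilateE ?lexx ?ler01 // mul0r subr0 invr1 scale1r addrC subrK. Qed.

Let T01 := [set z : Z | 0 <= z.2 <= 1].
Let T01_closed : closed T01.
Proof. exact: (closed_pre csnd (@closed_itv R 0 1)). Qed.

Let cnt i : continuous (fun z : Z => 2 * `|z.1 - k i| - (1 - z.2 / 2)).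
Proof.
apply: (@continuous_sub _ _ R^o).
  exact: (@continuous_compose _ _ _ _ _ cfst (@norm_sub_continuous i)).
apply: (@continuous_sub _ _ R^o); first exact: cst_continuous.
by apply: continuous_mul => //; exact: cst_continuous.
Qed.

Let cellT i := [set z : Z | cube_cell i z.1 /\ 0 <= z.2 <= 1].
Let cellT_closed i : closed (cellT i).
Proof. by apply: closedI => //; exact: (closed_pre cfst (@cube_cell_closed i)). Qed.

(* Dilating a cell pushes a collar of its boundary into X'. There, and on X',
   the homotopy is an extension into the absolute extensor X'. *)
Lemma collapse_homotopy : exists H : Z -> 'rV[R]_n,
  [/\ continuous_on (X `*` [set t : R | 0 <= t <= 1]) H,
      forall x t, X x -> 0 <= t <= 1 -> X (H (x, t)) ,
      forall x t, X' x -> 0 <= t <= 1 -> X' (H (x, t)),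
      forall x, X x -> H (x, 0) = x & forall x, X' x -> H (x, 1) = p].
Proof.
(* The data for the extension into [X']: the identity on [X'] at time 0 ([b] false), the constant
   [p] on [X'] at time 1 ([b] true), and on each cell the dilation at those points that it brings
   exactly to the boundary. *)
pose C0 (c : bool + 'I_N) := match c with
  | inl b => [set z : Z | X' z.1 /\ z.2 = b%:R]
  | inr i => cellT i `&` [set z | 2 * `|z.1 - k i| = 1 - z.2 / 2] end.
pose f0 (c : bool + 'I_N) := match c with
  | inl b => fun z : Z => if b then p else z.1 | inr i => dilate i end.
have [f cf fE] : exists2 f : Z -> 'rV[R]_n, continuous_on (\bigcup_c C0 c) f &
    forall c z, C0 c z -> f z = f0 c z.
  apply: glue_family => //.
    move=> [b|i]; last first.
      apply: continuous_onW; last exact: dilate_continuous.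
      apply: closedI => //.
      rewrite [X in closed X](_ : _ = (fun z : Z => 2 * `|z.1 - k i| - (1 - z.2 / 2)) @^-1` [set r | 0 <= r <= 0]).
        by apply: closed_pre; [exact: cnt|exact: closed_itv].
      apply/seteqP; split=> z /=; first by move=> ->; rewrite subrr lexx.
      by move=> ?; apply/eqP; rewrite -subr_eq0; apply/eqP/le_anti; rewrite andbC.
    apply: continuous_onW; last by case: b => // z; exact: cvg_cst.
    apply: closedI; first exact: closed_pre.
    rewrite [X in closed X](_ : _ = snd @^-1` [set r : R | b%:R <= r <= b%:R]).
      by apply: closed_pre; [exact: csnd|exact: closed_itv].
    apply/seteqP; split=> z /=; first by move=> ->; rewrite lexx.
    by move=> ?; apply/le_anti; rewrite andbC.
  (* A point common to [X'] and a cell has radial coordinate 1; it is on the moving boundary at time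
     0 only, when the dilation is the identity. *)
  have mix b i z : C0 (inl b) z -> C0 (inr i) z -> f0 (inl b) z = f0 (inr i) z.
    case: z => x t /= [/= Xx tb] [[/= sx t01] xt]; move: xt; rewrite /= (cell_core sx Xx) => xt.
    have t0 : t = 0 by lra.
    case: b tb => [/=|_]; first by rewrite t0 => /esym/eqP; rewrite oner_eq0.
    by rewrite t0 dilate0.
  move=> [b|i] [b'|j] z; [|exact: mix|by move=> *; apply/esym; exact: mix|].
    move=> [_ zb] [_]; rewrite zb => /eqP; rewrite eqr_nat => /eqP.
    by case: b {zb} => /=; case: b'.
  case: (eqVneq i j) => [->//|ij] [[si t01] zt] [[sj _] _].
  move: zt; rewrite /= (cell_cell ij si sj) => zt; have t0 : z.2 = 0 by lra.
  by move: t0; case: (z) => x t /= ->; rewrite !dilate0.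
have [z [c _ cz]|G [cG Gf GX']] := X'_AE (@pseudometric_perfectly_normal R ('rV[R]_n * R)%type) cf.
- rewrite (fE c) //; case: c cz => [[] [? ?]|i [[sz t01] zt]] //.
  case: z sz t01 zt => x t /= sz t01 zt; apply: (@cell_boundary i).
    by apply: dilate_cell => //; rewrite zt.
  by rewrite norm_dilate // zt mulVf //; case/andP: t01 => *; apply/eqP; lra.
(* The extension [G] takes over on [X'] and on the collar that dilation would push out of the cell;
   inside, the dilation is used. *)
pose Q := [set z : Z | X' z.1 /\ 0 <= z.2 <= 1] `|`
  \bigcup_i (cellT i `&` [set z | 1 - z.2 / 2 <= 2 * `|z.1 - k i| ]).
pose D (c : option 'I_N) := if c is Some i
  then cellT i `&` [set z | 2 * `|z.1 - k i| <= 1 - z.2 / 2] else Q.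
pose h (c : option 'I_N) := if c is Some i then dilate i else G.
have GE c z : C0 c z -> G z = f0 c z.
  by move=> Cz; rewrite Gf ?(fE c) // inE; exists c.
have [H cH HE] : exists2 H : Z -> 'rV[R]_n, continuous_on (\bigcup_c D c) H &
    forall c z, D c z -> H z = h c z.
  apply: glue_family => //.
    move=> [i|]; apply: continuous_onW => //; [|exact: dilate_continuous|].
      apply: closedI => //.
      rewrite [X in closed X](_ : _ = (fun z : Z => 2 * `|z.1 - k i| - (1 - z.2 / 2)) @^-1` [set r | r <= 0]).
        by apply: closed_pre; [exact: cnt|exact: closed_le].
      by apply/seteqP; split=> z /=; rewrite subr_le0.
    apply: closedU; first by apply: closedI => //; exact: closed_pre.
    apply: closed_bigcup; first exact: finite_finset.
    move=> i _; apply: closedI => //.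
    rewrite [X in closed X](_ : _ = (fun z : Z => 2 * `|z.1 - k i| - (1 - z.2 / 2)) @^-1` [set r | 0 <= r]).
      by apply: closed_pre; [exact: cnt|exact: closed_ge].
    by apply/seteqP; split=> z /=; rewrite subr_ge0.
  have mix i z : D (Some i) z -> D None z -> dilate i z = G z.
    move=> [[si t01] zt] Qz; rewrite (GE (inr i)) //; split=> //=.
    case: Qz => [[Xz _]|[j _ [[sj _] zj]]].
      have zi := cell_core si Xz; move: zt => /=; rewrite zi => zt.
      by case/andP: t01 => *; lra.
    have [ij|ij] := eqVneq i j; first by apply/le_anti; rewrite zt /= ij zj.
    have zi := cell_cell ij si sj; move: zt => /=; rewrite zi => zt.
    by case/andP: t01 => *; lra.
  move=> [i|] [j|] z //; [|exact: mix|by move=> *; apply/esym; exact: mix].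
  case: (eqVneq i j) => [->//|ij] [[si t01] zt] [[sj _] _].
  move: zt; rewrite /= (cell_cell ij si sj) => zt; have t0 : z.2 = 0 by case/andP: t01 => *; lra.
  by move: t0; case: (z) => x t /= ->; rewrite !dilate0.
have HX' x t : X' x -> 0 <= t <= 1 -> H (x, t) = G (x, t).
  by move=> Xx t01; rewrite (HE None) //; left.
exists H; split.
- apply: continuous_onS cH; last first.
    move=> [x t] [/= Xx t01]; case: (X_cover Xx) => [X'x|[i si]].
      by exists None => //; left.
    case: (leP (2 * `|x - k i|) (1 - t / 2)) => xt; first by exists (Some i).
    by exists None => //; right; exists i => //; split=> //; exact: ltW.
  apply: closedI; last exact: T01_closed.
  apply: closed_pre => //; apply: compact_closed => //; exact: norm_hausdorff.
- move=> x t Xx t01; case: (X_cover Xx) => [X'x|[i si]].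
    by rewrite HX' //; exact/X'X/GX'.
  case: (leP (2 * `|x - k i|) (1 - t / 2)) => xt.
    by rewrite (HE (Some i)) //; apply: (@cell_sub i); exact: dilate_cell.
  rewrite (HE None); first exact/X'X/GX'.
  by right; exists i => //; split=> //; exact: ltW.
- by move=> x t Xx t01; rewrite HX'.
- move=> x Xx; have t01 : (0 : R) <= 0 <= (1 : R) by apply/andP; split; lra.
  case: (X_cover Xx) => [X'x|[i si]].
    by rewrite HX' // (GE (inl false)).
  rewrite (HE (Some i)) /= ?dilate0 //; split=> //=.
  by rewrite mul0r subr0; case: si.
- move=> x X'x; have t01 : (0 : R) <= 1 <= (1 : R) by apply/andP; split; lra.
  by rewrite HX' // (GE (inl true)).
Qed.

Definition chart i (x : 'rV[R]_n) : 'rV[R]_d := \row_j (2 * (x - k i) 0 (pos i j)).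

Lemma chartE i x j : chart i x 0 j = 2 * (x - k i) 0 (pos i j).
Proof. exact: mxE. Qed.

Definition unchart i (y : 'rV[R]_d) : 'rV[R]_n :=
  k i + 2^-1 *: \sum_j y 0 j *: delta_mx 0 (pos i j).

Lemma unchart_pos i y j : (unchart i y - k i) 0 (pos i j) = 2^-1 * y 0 j.
Proof.
rewrite /unchart addrAC subrr add0r mxE summxE (bigD1 j) //= big1 ?addr0.
  by rewrite !mxE !eqxx mulr1.
by move=> l lj; rewrite !mxE (inj_eq (pos_inj (i := i))) eq_sym (negbTE lj) andbF mulr0.
Qed.

Lemma unchart_out i y a : (forall j, pos i j != a) -> unchart i y 0 a = k i 0 a.
Proof.
move=> ha; rewrite /unchart !mxE summxE big1 ?mulr0 ?addr0 // => j _.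
by rewrite !mxE eq_sym (negbTE (ha j)) andbF mulr0.
Qed.

Lemma norm_chart i x : cube_cell i x -> `|chart i x| = 2 * `|x - k i|.
Proof.
move=> [_ xa]; apply/le_anti/andP; split.
  apply/norm_row_le; first by rewrite mulr_ge0.
  by move=> j; rewrite chartE normrM ger0_norm // ler_pM2l // norm_row_entry.
rewrite -ler_pdivlMl //; apply/norm_row_le; first by rewrite mulr_ge0 ?invr_ge0.
move=> a; have [[j /eqP <-]|na] := pselect (exists j, pos i j == a).
  rewrite ler_pdivlMl //; apply: le_trans (norm_row_entry _ j).
  by rewrite chartE normrM ger0_norm.
rewrite !mxE xa; first by rewrite subrr normr0 mulr_ge0 ?invr_ge0.
by move=> j; apply/negP => ja; apply: na; exists j.
Qed.

Lemma chart_inj i x x' : cube_cell i x -> cube_cell i x' -> chart i x = chart i x' -> x = x'.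
Proof.
move=> [_ xa] [_ xa'] e; apply/rowP => a.
have [[j /eqP <-]|na] := pselect (exists j, pos i j == a).
  by have := congr1 (fun y : 'rV[R]_d => y 0 j) e; rewrite !mxE; lra.
by rewrite xa ?xa' // => j; apply/negP => ja; apply: na; exists j.
Qed.

Lemma chart_unchart i y : chart i (unchart i y) = y.
Proof. by apply/rowP => j; rewrite chartE unchart_pos mulrA divff ?mul1r. Qed.

Lemma cube_cell_unchart i y : `|y| <= 1 -> cube_cell i (unchart i y).
Proof.
move=> y1; split; last exact: unchart_out.
rewrite -ler_pdivlMl // mulr1; apply/norm_row_le; first by rewrite invr_ge0.
move=> a; have [[j /eqP <-]|na] := pselect (exists j, pos i j == a).
  rewrite unchart_pos normrM ger0_norm ?invr_ge0 //.
  by rewrite ler_piMr ?invr_ge0 //; exact: le_trans (norm_row_entry _ j) y1.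
rewrite !mxE -[X in X - _](_ : unchart i y 0 a = _); last by rewrite !mxE.
rewrite unchart_out ?subrr ?normr0 ?invr_ge0 //.
by move=> j; apply/negP => ja; apply: na; exists j.
Qed.

Lemma chart_continuous i : continuous (chart i).
Proof.
apply: continuous_row => j; under eq_fun do rewrite !mxE.
apply: continuous_mul; first exact: cst_continuous.
apply: (@continuous_sub _ _ R^o); last exact: cst_continuous.
exact: entry_continuous.
Qed.

Let W := wedge_spheres R d N.
Let wl i (z : sphere R d) : W := @wedge_lift _ _ (fun=> sphere_base R d) i z.
Let wb : W := wl i0 (sphere_base R d).

Let wl_base i : wl i (sphere_base R d) = wb.
Proof. exact: (@wedge_liftE _ _ (fun=> sphere_base R d) i0 (sphere_base R d) i (sphere_base R d)). Qed.

(** The wedge maps to the product of the spheres, with the base point in every coordinate but one;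
    it suffices to compare the coordinates [i] and [j]. *)
Let wl_inj i j z z' : wl i z = wl j z' ->
  i = j /\ z = z' \/ z = sphere_base R d /\ z' = sphere_base R d.
Proof.
move=> /(congr1 (@wedge_prod _ _ (fun=> sphere_base R d))).
rewrite /wedge_prod !wedge_lift_funE; try exact: wedge_prod_pointE.
move=> e; have := congr1 (fun f => f i) e; have := congr1 (fun f => f j) e.
rewrite !dfwithin; have [<-|ij] := eqVneq i j.
  by rewrite !dfwithin; left.
by rewrite !dfwithout // 1?eq_sym //; right.
Qed.

Let wl_surj (w : W) : exists i z, w = wl i z.
Proof.
have : [set: W] w by [].
by rewrite -(@wedgeTE _ _ (fun=> sphere_base R d)) => -[i _ [z _ <-]]; exists i, z.
Qed.

Let W_hausdorff : hausdorff_space W.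
Proof.
by apply: wedge_hausdorff => _; apply: hausdorff_subtype; exact: norm_hausdorff.
Qed.

Lemma crush_cells : exists q : 'rV[R]_n -> W, [/\ continuous_on X q,
  forall x, X' x -> q x = wb & forall i x, cube_cell i x -> q x = wl i (to_sphere (chart i x))].
Proof.
pose A (c : option 'I_N) := if c is Some i then cube_cell i else X'.
pose f (c : option 'I_N) x := if c is Some i then wl i (to_sphere (chart i x)) else wb.
have [q cq qE] : exists2 q : 'rV[R]_n -> W, continuous_on (\bigcup_c A c) q &
    forall c x, A c x -> q x = f c x.
  apply: glue_family; first exact: wb.
    move=> [i|]; last by apply: continuous_onW => //; exact: cst_continuous.
    apply: continuous_onW; first exact: cube_cell_closed.
    apply: (@continuous_compose _ _ _ _ (wl i)); last exact: (@wedge_lift_continuous 'I_N (fun=> set_type (sphere R d)) (fun=> sphere_base R d) i).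
    by apply: continuous_compose; [exact: chart_continuous|exact: to_sphere_continuous].
  have bdE i x : cube_cell i x -> 2 * `|x - k i| = 1 -> f (Some i) x = wb.
    by move=> si xi; rewrite /f (proj2 (to_sphere_bd _)) // norm_chart.
  move=> [i|] [j|] x //= Ax Bx.
  - have [<-//|ij] := eqVneq i j.
    transitivity wb; first exact: bdE Ax (cell_cell ij Ax Bx).
    by apply/esym; apply: bdE Bx (cell_cell _ Bx Ax); rewrite eq_sym.
  - exact: bdE Ax (cell_core Ax Bx).
  - by apply/esym; exact: bdE Bx (cell_core Bx Ax).
exists q; split.
- apply: continuous_onS cq; first by apply: compact_closed => //; exact: norm_hausdorff.
  by move=> x /X_cover[Xx|[i sx]]; [exists None|exists (Some i)].
- by move=> x Xx; rewrite (qE None).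
- by move=> i x sx; rewrite (qE (Some i)).
Qed.

(** The fibres of [q] are [X'] and the single points outside it. The homotopy [H] preserves [X'] and
    ends by sending it to a point, so its end map descends to an inverse [g], and [H] itself to a
    homotopy on the wedge. Compactness makes the descended maps continuous. *)
Theorem cell_wedge : hequiv R X W.
Proof.
have [H [cH HX HX' H0 H1]] := collapse_homotopy.
have [q [cq qX' q_cell]] := crush_cells.
have cX : closed X by apply: compact_closed => //; exact: norm_hausdorff.
have q_surj w : exists2 x, X x & q x = w.
  have [i [z ->]] := wl_surj w; have [->|zb] := eqVneq z (sphere_base R d).
    by exists p; [exact: X'X|rewrite qX' // wl_base].
  have [y y1 <-] := to_sphere_surj zb; have si := cube_cell_unchart i (ltW y1).
  by exists (unchart i y); [exact: (@cell_sub i)|rewrite (q_cell i) // chart_unchart].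
have q_fib x x' : X x -> X x' -> q x = q x' -> x = x' \/ X' x /\ X' x'.
  have qN i y : cube_cell i y -> ~ X' y -> `|chart i y| < 1.
    move=> si nX; rewrite norm_chart //; case: (si) => le1 _.
    by rewrite lt_neqAle le1 andbT; apply/eqP => e; apply: nX; exact: cell_boundary e.
  have bN i y : cube_cell i y -> ~ X' y -> to_sphere (chart i y) <> sphere_base R d.
    by move=> si nX /to_sphere_bd e; have := qN i y si nX; rewrite e ltxx.
  move=> Xx Xx'; have [x1|nx] := pselect (X' x); have [x1'|nx'] := pselect (X' x').
  - by right.
  - case: (X_cover Xx') => [//|[i si]]; rewrite qX' // (q_cell i) // -(wl_base i).
    by move=> /wl_inj[[_ /esym/bN]|[_ /bN]]; case.
  - case: (X_cover Xx) => [//|[i si]]; rewrite (q_cell i) // (qX' x') // -(wl_base i).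
    by move=> /wl_inj[[_ /bN]|[/bN]]; case.
  case: (X_cover Xx) => [//|[i si]]; case: (X_cover Xx') => [//|[j sj]].
  rewrite (q_cell i) // (q_cell j) // => /wl_inj[[ij]|[/bN]]; last by case.
  subst j; move=> /to_sphere_inj e; left; apply: (chart_inj si sj).
  by apply: e; exact: qN.
have fX t x : X x -> 0 <= t <= 1 -> H (x, t) \in X by move=> *; apply/mem_set/HX.
have valX (x : X) : X (val x) by apply/set_mem/valP.
have XK x : X x -> {u : X | val u = x} by move=> Xx; exists (SigSub (mem_set Xx)).
pose cl := clamp (0 : R) 1.
have clP t : 0 <= cl t <= 1 by exact: clamp_itv.
pose Hs (z : X * R) : X := SigSub (fX _ _ (valX z.1) (clP z.2)).
have cHs : continuous Hs.
  apply: continuous_into_subtype; apply: continuous_onT.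
  rewrite (_ : (fun z => _) = H \o (fun z : X * R => (val z.1, cl z.2))); last by apply/funext => z; rewrite set_valE.
  apply: (continuous_on_comp _ cH); last by move=> z _; split; [exact: valX|exact: clP].
  apply: continuous_onW; first exact: closedT.
  apply: continuous_pair.
    apply: (@continuous_compose (X * R)%type X _ (fun z => z.1) val); last exact: continuous_val.
    by move=> z; exact: cvg_fst.
  apply: (@continuous_compose (X * R)%type R _ (fun z => z.2) cl); last exact: clamp_continuous.
  by move=> z; exact: cvg_snd.
pose f (x : X) : W := q (val x).
have cf : continuous f.
  apply: continuous_onT; apply: (continuous_on_comp _ cq) => //.
  by apply: continuous_onW; [exact: closedT|exact: continuous_val].
have /choice[s sP] : forall w, exists x : X, f x = w.
  by move=> w; have [x /XK[u <-] <-] := q_surj w; exists u.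
(* The preimage [s w] is ambiguous only within [X'], all of which goes to [p] at time 1. *)
pose g (w : W) : X := Hs (s w, 1).
have cl0 : cl 0 = 0 by apply: clamp_id; apply/andP; split; lra.
have cl1 : cl 1 = 1 by apply: clamp_id; apply/andP; split; lra.
have clE t : 0 <= t <= 1 -> cl t = t by exact: clamp_id.
have sq x (Xx : X x) : val (s (q x)) = x \/ X' (val (s (q x))) /\ X' x.
  by apply: q_fib => //; have := sP (q x).
have gE x : X x -> val (g (q x)) = H (x, 1).
  by move=> Xx; rewrite /g /= cl1; case: (sq x Xx) => [->//|[h1 h2]]; rewrite !H1.
have qT : q @` X = setT by apply/seteqP; split=> // w _; have [x Xx <-] := q_surj w; exists x.
have cH1 t : 0 <= t <= 1 -> continuous_on X (fun x => H (x, t)).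
  move=> t01; apply: (continuous_on_comp (f := fun x => (x, t)) _ cH) => //.
  apply: continuous_onW => //; apply: continuous_pair; last exact: cst_continuous.
  by move=> x; exact: cvg_id.
have cg : continuous g.
  apply: continuous_into_subtype; apply: continuous_onT; rewrite -qT.
  apply: (compact_descent (h := fun x => H (x, 1))) => //.
  by apply: cH1; apply/andP; split; lra.
exists f, g; split => //.
  apply: homot_sym; exists Hs; split => // x; apply/val_inj => /=.
    by rewrite cl0 H0 //; exact: valX.
  by rewrite cl1 -(gE _ (valX x)) /g /= cl1.
pose K (z : W * R) : W := f (Hs (s z.1, z.2)).
have KE x t : X x -> 0 <= t <= 1 -> K (q x, t) = q (H (x, t)).
  move=> Xx t01; rewrite /K /f /= clE //; case: (sq x Xx) => [->//|[h1 h2]].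
  by rewrite (qX' _ (HX' _ _ h1 t01)) (qX' _ (HX' _ _ h2 t01)).
(* Descent needs a compact source, so the homotopy is first handled for times in the unit interval;
   the other times are clamped. *)
pose A := X `*` [set t : R | 0 <= t <= 1].
have cA : compact A.
  apply: compact_setX => //; rewrite (_ : [set t | _] = `[0, 1]%classic); first exact: segment_compact.
  by apply/seteqP; split=> t /=; rewrite in_itv.
have cA' : closed A by apply: continuous_on_closed cH.
have cK : continuous_on ((fun z : 'rV[R]_n * R => (q z.1, z.2)) @` A) K.
  apply: (compact_descent (h := q \o H)) => //.
  - by apply: hausdorff_pair => //; exact: Rhausdorff.
  - apply: continuous_on_pair; last exact: continuous_onW.
    apply: (@continuous_on_comp _ _ _ A X (fun z => z.1) q) => //; first exact: continuous_onW.
    by move=> z [].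
  - by apply: continuous_on_comp cH cq _ => -[x t] [/= Xx t01]; exact: HX.
  - by move=> [x t] [/= Xx t01]; exact: KE.
apply: homot_sym; exists (K \o (fun z : W * R => (z.1, cl z.2))); split.
- apply: continuous_onT; apply: (continuous_on_comp _ cK).
    apply: continuous_onW; first exact: closedT.
    apply: continuous_pair; first by move=> z; exact: cvg_fst.
    apply: (@continuous_compose (W * R)%type R _ (fun z => z.2) cl); last exact: clamp_continuous.
    by move=> z; exact: cvg_snd.
  by move=> [w t] _ /=; have [x Xx <-] := q_surj w; exists (x, cl t) => //; split=> //; exact: clP.
- by move=> w /=; have [x Xx <-] := q_surj w; rewrite cl0 KE ?H0 ?lexx ?ler01.
- move=> w /=; have [x Xx <-] := q_surj w; by rewrite cl1 KE ?lexx ?ler01 // -(gE _ Xx).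
Qed.

End CellAttachment.

(** * The number of removed cells *)

Section SphereCount.

(** The identity holds term by term: (k + 1) C(k, a + 1) = (k - a) C(k + 1, a + 1), the signs of the
    two sums are opposite, and k - (k - a) = a supplies the additional factor a. *)
Lemma num_spheres_S k n : num_spheres k.+1 n.+1 =
  k%:Z * num_spheres k.+1 n + k.+1%:Z * num_spheres k n.
Proof.
rewrite /num_spheres; case: k => [|k]; first by rewrite !big_geq // mulr0.
have -> : \sum_(1 <= a < k.+1) (-1) ^+ (k.+1 + a + 1) * ('C(k.+1, a.+1) * a ^ n)%:Z =
    \sum_(1 <= a < k.+2) (-1) ^+ (k.+1 + a + 1) * ('C(k.+1, a.+1) * a ^ n)%:Z :> int.
  by rewrite [RHS]big_nat_recr //= bin_small // mul0n mulr0 addr0.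
rewrite !mulr_sumr -big_split /=; apply: eq_big_nat => a /andP[a1 ak].
have := mul_bin_down k.+2 a.+1; rewrite /= => e.
have {}e : k.+2%:Z * ('C(k.+1, a.+1))%:Z = (k.+1%:Z - a%:Z) * ('C(k.+2, a.+1))%:Z.
  by rewrite -PoszM e PoszM -subzn //; congr (_ * _); lia.
rewrite expnS !PoszM !addSn !exprS mulrCA [X in _ + X]mulrCA.
rewrite [X in _ = _ + _ * X]mulrA e; ring.
Qed.

(** The alternating sum of a row of binomial coefficients vanishes; its first two terms, 1 and -(k +
    1), are the ones missing here. *)
Lemma num_spheres_0 k : num_spheres k.+1 0 = (-1) ^+ k.+1 * k%:Z.
Proof.
have : \sum_(i < k.+2) (-1) ^+ i * ('C(k.+1, i))%:Z = (1 - 1 : int) ^+ k.+1.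
  rewrite exprBn; apply: eq_bigr => i _.
  by rewrite !expr1n !mulr1 -mulr_natr natz.
rewrite subrr expr0n /= !big_ord_recl /= bin0 bin1 => h.
rewrite /num_spheres big_add1 /= big_mkord.
under eq_bigr => i _ do rewrite expn0 muln1 -addnA addn1 exprD -mulrA.
rewrite -mulr_sumr; congr (_ * _).
have {}h : 1 + (- 1 * k.+1%:Z + \sum_(i < k) (-1) ^+ i.+2 * ('C(k.+1, i.+2))%:Z) = 0 :> int.
  by rewrite -[RHS]h; congr (_ + (_ + _)); apply: eq_bigr.
move/eqP: h; rewrite addrA addrC addr_eq0 => /eqP ->; lia.
Qed.

(** On the diagonal the recurrence refers to values with n < k, where the complex is empty; up to
    the sign (-1)^(n - k) they are its reduced Euler characteristic -1. At n = 0 this fails because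
    the sum lacks the term with a = 0. *)
Lemma num_spheres_lt k n : (0 < n < k)%N -> num_spheres k n = (-1) ^+ (k + n + 1).
Proof.
elim: n k => // n IH [//|k] /andP[_ nk]; rewrite num_spheres_S.
have [->|n0] := eqVneq n 0%N.
  case: k nk => // k _; rewrite !num_spheres_0 !addn1 !exprS.
  have -> : k.+2%:Z = k%:Z + 2 by lia.
  have -> : k.+1%:Z = k%:Z + 1 by lia.
  by move: ((-1) ^+ k) (k%:Z) => x y; ring.
have -> : k.+1%:Z = k%:Z + 1 by lia.
rewrite !IH; try lia.
rewrite !addn1 !addSn !addnS !exprS.
by move: ((-1) ^+ (k + n)) (k%:Z) => x y; ring.
Qed.

(** The base case of the count: k! isolated points form a wedge of k! - 1 spheres of dimension 0. *)
Lemma num_spheres_diag k : (0 < k)%N -> num_spheres k k = (k`!)%:Z - 1.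
Proof.
elim: k => // -[|k] IH _; first by rewrite /num_spheres big_geq.
rewrite num_spheres_S IH // num_spheres_lt ?ltnS ?leqnn //.
rewrite [(k.+2)`!]factS PoszM.
rewrite (_ : k.+2 + k.+1 + 1 = 2 * k.+2)%N; last by lia.
rewrite exprM sqrrN !expr1n mulr1.
have -> : k.+2%:Z = k.+1%:Z + 1 by lia.
by move: (Posz (k.+1)`!) (k.+1%:Z) => x y; ring.
Qed.

Lemma size_allpairs_const (A B : eqType) (C : Type) (f : A -> B -> C) (s : seq A) (t : A -> seq B) (N : nat) :
  {in s, forall x, size (t x) = N} -> size [seq f x y | x <- s, y <- t x] = (size s * N)%N.
Proof.
elim: s => //= x s IH h; rewrite size_cat size_map h ?mem_head // IH // => y ys.
by apply: h; rewrite inE ys orbT.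
Qed.

Lemma size_removed_words n S : uniq S -> (size S <= n)%N ->
  (size (removed_words n S))%:Z = num_spheres (size S) n.
Proof.
elim: n S => [|n IH] S uS; first by case: S uS => // _ _; rewrite /num_spheres big_geq.
move=> sS /=; case: eqP => [->|/eqP S0]; first by rewrite /num_spheres big_geq.
case: eqP => [sn|/eqP sn].
  rewrite size_map size_filter -sn num_spheres_diag; last by case: (S) S0.
  have := count_predC (pred1 S) (permutations S).
  rewrite (count_uniq_mem _ (permutations_uniq S)) mem_permutations perm_refl.
  rewrite size_permutations // => h.
  by rewrite -h /= PoszD addrAC subrr add0r.
have {}sS : (size S <= n)%N by move: sS; rewrite leq_eqVlt (negbTE sn).
case: S uS S0 sn sS => // s S uS _ _ sS.
(* Deleting any one marked point leaves a list of the same size, hence the same number of removed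
   words by induction. *)
have [N eN] : exists N, forall t, t \in s :: S -> size (removed_words n (rem t (s :: S))) = N.
  case: (n) (IH) sS => // n' IH' sS.
  exists (absz (num_spheres (size S) n'.+1)) => t tS.
  have st : size (rem t (s :: S)) = size S by rewrite size_rem.
  have := IH' _ (rem_uniq t uS); rewrite st => <- //; exact: ltnW.
have eN' : N%:Z = num_spheres (size S) n.
  rewrite -(eN s (mem_head _ _)) IH ?rem_uniq //; first by rewrite size_rem ?mem_head.
  by rewrite size_rem ?mem_head //=; exact: ltnW.
rewrite size_cat (size_allpairs_const _ (N := N)); last by move=> t /eN.
rewrite (size_allpairs_const _ (N := size (removed_words n (s :: S)))) //.
by rewrite PoszD !PoszM IH // eN' num_spheres_S addrC.
Qed.

(** This provides the cell without which the wedge would be empty. The edge on the left of the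
    second marked point carries the induction, which starts from k! - 1 > 0. *)
Lemma removed_words_gt0 n S : uniq S -> (1 < size S <= n)%N -> (0 < size (removed_words n S))%N.
Proof.
elim: n S => [|n IH] S uS /andP[S1 Sn]; first by case: (S) S1 Sn.
have [sn|/eqP sn] := eqVneq (size S) n.+1.
  have := size_removed_words uS Sn; rewrite -sn num_spheres_diag ?(ltnW S1) //.
  by have := fact_geq (size S); lia.
have {}Sn : (size S <= n)%N by move: Sn; rewrite leq_eqVlt => /predU1P[].
have := IH S uS; rewrite S1 Sn => /(_ isT).
case: S uS S1 Sn sn => [|s [|t S]] // uS S1 Sn sn; set T := [:: s, t & S] in uS sn *.
rewrite [removed_words n.+1 T]/= -/T; case: eqP => // _.
by rewrite size_cat /=; case: (removed_words n T) => // w ws; rewrite !(size_cat, size_map) /= addnS.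
Qed.

Lemma uniq_cons_pairs (f : nat -> nat) (T : seq nat) (W : nat -> seq (seq nat)) :
  uniq T -> {in T &, injective f} -> {in T, forall t, uniq (W t)} ->
  uniq [seq f t :: w | t <- T, w <- W t].
Proof.
elim: T => //= t T IH /andP[tT uT] fi uW; rewrite cat_uniq.
rewrite map_inj_uniq ?uW ?mem_head ?IH //; last by move=> u v [].
- rewrite andbT /=; apply/hasPn => _ /allpairsPdep[u [w [uT' _ ->]]].
  apply/mapP => -[w' _ [e _]]; move/negP: tT; apply.
  by rewrite -(fi u t _ _ e) ?mem_head // inE uT' orbT.
- by move=> u v uT' vT; apply: fi; rewrite inE ?uT' ?vT orbT.
- by move=> u uT'; apply: uW; rewrite inE uT' orbT.
Qed.

(** The two families of words are told apart by the parity of the first letter. *)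
Lemma uniq_removed_words n S : sorted ltn S -> uniq (removed_words n S).
Proof.
elim: n S => [|n IH] S srt //=; have uS := sorted_uniq ltn_trans ltnn srt.
case: eqP => // /eqP S0; case: eqP => [sn|/eqP sn].
  rewrite map_inj_in_uniq; first by rewrite filter_uniq ?permutations_uniq.
  by move=> p q _ _; apply: inj_map; exact: double_inj.
have uB : uniq (behead S) by case: (S) uS => //= s T /andP[].
rewrite cat_uniq !uniq_cons_pairs //=.
- rewrite andbT; apply/hasPn => _ /allpairsPdep[t [w [tS _ ->]]].
  apply/allpairsPdep => -[u [v [_ _ [e _]]]].
  have t0 := sorted_gt0 srt tS; have : odd t.*2.-1 by rewrite -[t]prednK // doubleS /= odd_double.
  by rewrite e odd_double.
- by move=> t u /(sorted_gt0 srt) t0 /(sorted_gt0 srt) u0 e; apply: double_inj; lia.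
- by move=> t _; exact: IH.
- by move=> t u _ _; exact: double_inj.
- by move=> t _; apply: IH; exact: (subseq_sorted ltn_trans (rem_subseq _ _)).
Qed.

End SphereCount.

(** * The interval model is a wedge of spheres *)

Section IntervalModelCells.
Variables (R : realType) (m n : nat) (S : seq nat).
Hypotheses (srt : sorted ltn S) (aS : all (fun s => s <= m)%N S) (sS : (1 < size S <= n)%N).
Let d := (n - size S)%N.
Let N := size (removed_words n S).
Let word (i : 'I_N) := nth [::] (removed_words n S) i.
Let uS : uniq S := sorted_uniq ltn_trans ltnn srt.
Let Sn : (size S <= n)%N. Proof. by case/andP: sS. Qed.

Let wordP i : [/\ size (word i) = n, perm_eq (evens (word i)) (map double S) &
  all (fun c => c <= m.*2)%N (word i)].
Proof. by apply: (removed_words_wf srt aS Sn); exact: mem_nth. Qed.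

Let free i := [set a : 'I_n | odd (nth 0%N (word i) a)]%SET.

Let card_free i : d = #|free i|.
Proof.
have [sw pw _] := wordP i.
have -> : #|free i| = count odd (word i).
  rewrite cardE size_filter -[word i in RHS](@mkseq_nth _ 0%N) sw /mkseq -val_enum_ord.
  rewrite -map_comp count_map enumT; apply: eq_count => a.
  by rewrite !inE.
have := count_predC odd (word i); rewrite sw /d.
have -> : count (predC odd) (word i) = size S.
  by rewrite -size_filter (perm_size pw) size_map.
by move <-; rewrite addnK.
Qed.

Let pos i (j : 'I_d) : 'I_n := enum_val (cast_ord (card_free i) j).

Let pos_inj i : injective (pos i).
Proof. by move=> j j' /enum_val_inj/cast_ord_inj. Qed.

Let posP i a : (exists j, pos i j = a) <-> odd (nth 0%N (word i) a).
Proof.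
split=> [[j <-]|oa]; first by have := enum_valP (cast_ord (card_free i) j); rewrite inE.
have af : a \in free i by rewrite inE.
by exists (cast_ord (esym (card_free i)) (enum_rank_in af a)); rewrite /pos cast_ordKV enum_rankK_in.
Qed.

Let k i : 'rV[R]_n := \row_a ((nth 0%N (word i) a)%:R / 2).

Definition ccell (c : nat) (r : R) : Prop :=
  if odd c then is_true (`|r - c%:R / 2| <= 1 / 2) else r = c%:R / 2.

Let cellP i x : cube_cell k pos i x <-> forall a : 'I_n, ccell (nth 0%N (word i) a) (x 0 a).
Proof.
rewrite /cube_cell /= -ler_pdivlMl // mulr1 norm_row_le ?invr_ge0 //; split.
  move=> [h1 h2] a; rewrite /ccell; case: ifP => oa.
    by have := h1 a; rewrite !mxE div1r.
  rewrite h2 ?mxE // => j; apply/eqP => ja; move: oa; suff -> : odd (nth 0%N (word i) a) by [].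
  by apply/posP; exists j.
move=> h; split=> a; have := h a; rewrite /ccell !mxE.
  by case: ifP => _; [rewrite div1r|move=> ->; rewrite subrr normr0 invr_ge0].
case: ifP => // /posP[j <-] _ /(_ j); by rewrite eqxx.
Qed.

Let norm_lt1 i x : cube_cell k pos i x ->
  (2 * `|x - k i| < 1 <-> @ocells R n (word i) x).
Proof.
move=> /cellP h; have e : (2 * `|x - k i| < 1) = (`|x - k i| < 2^-1).
  by rewrite -ltr_pdivlMl // mulr1.
rewrite e [X in X < _]mx_normrE; split.
  move=> /bigmax_ltP[_ h1] a; have := h a; rewrite /ccell /ocell; case: ifP => // _ _.
  by have := h1 (0, a) isT; rewrite !mxE div1r.
move=> h1; apply/bigmax_ltP; split; first by rewrite invr_gt0.
move=> [a0 a] _ /=; rewrite ord1; have := h1 a; rewrite /ocell !mxE.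
by case: ifP => _; [rewrite div1r|move=> ->; rewrite subrr normr0 invr_gt0].
Qed.

Let ocells_cell i x : @ocells R n (word i) x -> cube_cell k pos i x.
Proof.
move=> h; apply/cellP => a; have := h a; rewrite /ocell /ccell.
by case: ifP => // _ /ltW.
Qed.

Let cell_interior i x : cube_cell k pos i x -> 2 * `|x - k i| <> 1 -> @ocells R n (word i) x.
Proof.
move=> si ne; apply/(norm_lt1 si); case: (si) => le1 _.
by rewrite lt_neqAle le1 andbT; apply/eqP.
Qed.

Lemma odd_halfR c : odd c -> c%:R / 2 = (c./2)%:R + 1 / 2 :> R.
Proof.
move=> oc; rewrite -[in LHS](odd_double_half c) oc natrD -mul2n natrM /=; lra.
Qed.

Lemma even_halfR c : ~~ odd c -> c%:R / 2 = (c./2)%:R :> R.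
Proof.
move=> oc; rewrite -[in LHS](odd_double_half c) (negbTE oc) add0n -mul2n natrM; lra.
Qed.

Let cell_sub i : cube_cell k pos i `<=` @hitting R m n S.
Proof.
move=> x /cellP h; have [sw pw aw] := wordP i; split.
  move=> a; have := h a; rewrite /ccell.
  have cm : (nth 0%N (word i) a <= m.*2)%N by apply: (allP aw); rewrite mem_nth ?sw.
  case: ifP => oa.
    rewrite odd_halfR // ler_norml => /andP[h1 h2].
    (* An odd letter below [m.*2] is at most [m.*2.-1], so the right end of its edge does not exceed
       [m]. *)
    have : ((nth 0%N (word i) a)./2.+1 <= m)%N.
      move: cm (oa); rewrite -[nth _ _ _]odd_double_half; lia.
    rewrite -(ler_nat R) -addn1 natrD => h3.
    have := ler0n R (nth 0%N (word i) a)./2.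
    by move=> h4; apply/andP; split; lra.
  move=> ->; rewrite even_halfR ?oa // ler0n ler_nat -(doubleK m) half_leq //.
move=> s sS'; have : s.*2 \in evens (word i) by rewrite (perm_mem pw) map_f.
rewrite mem_filter odd_double /= => sw'.
have ii : (index s.*2 (word i) < n)%N by rewrite -sw index_mem.
exists (Ordinal ii); have := h (Ordinal ii); rewrite /ccell /= nth_index // odd_double.
by rewrite even_halfR ?odd_double // doubleK.
Qed.

(** In an edge coordinate of word [i] the point is not an integer, which forces the same letter in
    word [j]. So the free coordinates of [i] are free for [j]; both words have [d] of them, and the
    remaining letters can be read off from [x]. *)
Let ocells_ccells i j x : @ocells R n (word i) x -> cube_cell k pos j x -> i = j.
Proof.
move=> hi /cellP hj; have [si _ _] := wordP i; have [sj _ _] := wordP j.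
have oo (a : 'I_n) : odd (nth 0%N (word i) a) -> nth 0%N (word j) a = nth 0%N (word i) a.
  move=> oa; have := hi a; have := hj a; rewrite /ocell /ccell oa.
  case: ifP => ob; last first.
    rewrite even_halfR ?ob // => -> ; move: (_./2) => t h.
    have : ocell (nth 0%N (word i) a) (t%:R : R) by rewrite /ocell oa.
    by move/ocell_nat => e; move: oa; rewrite e odd_double.
  rewrite !odd_halfR // ler_norml ltr_norml => /andP[h1 h2] /andP[h3 h4].
  have e : (nth 0%N (word j) a)./2 = (nth 0%N (word i) a)./2.
    have l1 : ((nth 0%N (word j) a)./2 < (nth 0%N (word i) a)./2.+1)%N.
      by rewrite -(ltr_nat R) -(addn1 (_./2)) natrD; lra.
    have l2 : ((nth 0%N (word i) a)./2 < (nth 0%N (word j) a)./2.+1)%N.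
      by rewrite -(ltr_nat R) -(addn1 (_./2)) natrD; lra.
    lia.
  by rewrite -[LHS]odd_double_half -[RHS]odd_double_half ob oa e.
have ff : free i = free j.
  apply/eqP; rewrite eqEcard -!card_free leqnn andbT.
  by apply/fintype.subsetP => a; rewrite !inE => oa; rewrite oo.
apply/val_inj/eqP; rewrite -(nth_uniq [::] (ltn_ord i) (ltn_ord j) (uniq_removed_words n srt)); apply/eqP.
apply: (@eq_from_nth _ 0%N); first by rewrite -/(word i) -/(word j) si.
rewrite -/(word i) -/(word j) si => a' an; pose a := Ordinal an.
have [oa|ea] := boolP (odd (nth 0%N (word i) a')); first by rewrite (oo a).
have eb : ~~ odd (nth 0%N (word j) a').
  have : a \notin free j by rewrite -ff inE.
  by rewrite inE.
have := hi a; have := hj a; rewrite /ocell /ccell /= (negbTE ea) (negbTE eb) => ->.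
rewrite !even_halfR // => /eqP; rewrite eqr_nat => /eqP e.
move: e ea eb; move: (nth 0%N (word i) a') (nth 0%N (word j) a') => u v e eu ev.
by rewrite -(odd_double_half u) -(odd_double_half v) (negbTE eu) (negbTE ev) e.
Qed.

Theorem hitting_wedge : hequiv R (@hitting R m n S) (wedge_spheres R d N).
Proof.
have [cP aP] := AE_hitting_core R srt aS Sn.
have core_sub : @hitting_core R m n S `<=` @hitting R m n S by move=> x [].
have cX : compact (@hitting R m n S).
  apply: (@subclosed_compact _ _ [set v : 'rV[R]_n | forall i, (`[0, m%:R]%classic : set R) (v ord0 i)]).
  - exact: hitting_closed.
  - by apply: (@rV_compact R n (fun=> `[0, m%:R]%classic)) => _; exact: segment_compact.
  - by move=> x [xJ _] i; rewrite /= in_itv /= xJ.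
have i0 : 'I_N by exists 0%N; exact: (removed_words_gt0 uS sS).
(* Extending the empty map yields a point of the core, to which the core is contracted. *)
have [g [_ _ gP]] : exists g : R -> 'rV[R]_n,
    [/\ continuous g, {in set0, g =1 fun=> 0} & forall z, @hitting_core R m n S (g z)].
  apply: aP => //; first exact: (@pseudometric_perfectly_normal R R).
  by apply: continuous_onW; [exact: closed0|exact: cst_continuous].
have cell_cell i j x : i != j -> cube_cell k pos i x -> cube_cell k pos j x -> 2 * `|x - k i| = 1.
  move=> ij si sj; apply: contrapT => /(cell_interior si)/ocells_ccells/(_ sj) e.
  by move: ij; rewrite e eqxx.
apply: (@cell_wedge R n d N (@hitting R m n S) (@hitting_core R m n S) k pos (g 0)) => //.
- move=> x xX; have [xP|nP] := pselect (@hitting_core R m n S x); [by left|right].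
  have [w [wR wx]] : exists w, w \in removed_words n S /\ @ocells R n w x.
    by apply: contrapT => h; apply: nP; split=> // w wR wx; apply: h; exists w.
  have wi : (index w (removed_words n S) < N)%N by rewrite index_mem.
  by exists (Ordinal wi); apply: ocells_cell; rewrite /word /= nth_index.
- move=> i x si [_ xP]; apply: contrapT => /(cell_interior si).
  by apply: xP; exact: mem_nth.
- move=> i x si xi; split; first exact: (cell_sub si).
  move=> w wR; have wi : (index w (removed_words n S) < N)%N by rewrite index_mem.
  rewrite -[w](nth_index [::] wR) => wx; have wx' : @ocells R n (word (Ordinal wi)) x by [].
  have := ocells_ccells wx' si => ei; have := proj2 (norm_lt1 (ocells_cell wx')) wx'.
  by rewrite ei xi ltxx.
Qed.

End IntervalModelCells.

(** * The topology of pointwise convergence *)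

Section PointwiseTopology.

Lemma continuous_into_ptws (Z T : topologicalType) (I : Type) (f : Z -> {ptws I -> T}) :
  (forall i, continuous (fun z => f z i)) -> continuous f.
Proof.
move=> cf x; apply/cvg_sup.
move=> i; move: x; apply/(@continuousP _ (initial_topology (fun g : I -> T => g i))) => A [B oB <-].
exact: (proj1 (continuousP _) (cf i) B oB).
Qed.

Lemma eval_ptws_continuous (T : topologicalType) (I : eqType) (i : I) :
  continuous (fun g : {ptws I -> T} => g i).
Proof. exact: (@proj_continuous I (fun=> T) i). Qed.

(** Up to an enumeration of [V], functions on [V] are row vectors, and these carry a metric. *)
Lemma perfectly_normal_ptws (R : realType) (V : finType) : perfectly_normal R ({ptws V -> R} * R)%type.
Proof.
pose s (z : {ptws V -> R} * R) : 'rV[R]_#|V| * R := (\row_i z.1 (enum_val i), z.2).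
pose r (z : 'rV[R]_#|V| * R) : {ptws V -> R} * R := (fun v => z.1 0 (enum_rank v), z.2).
apply: (@perfectly_normal_section R _ _ s r).
- apply: continuous_pair; last by move=> z; exact: cvg_snd.
  apply: continuous_row => i.
  rewrite (_ : (fun z => _) = (fun z : {ptws V -> R} * R => z.1 (enum_val i))); last first.
    by apply/funext => z; rewrite mxE.
  apply: (@continuous_compose _ {ptws V -> R} R (fun z => z.1) (fun g => g (enum_val i))).
    by move=> z; exact: cvg_fst.
  exact: eval_ptws_continuous.
- apply: continuous_pair; last by move=> z; exact: cvg_snd.
  apply: continuous_into_ptws => v.
  apply: (@continuous_compose _ 'rV[R]_#|V| R (fun z => z.1) (fun x => x 0 (enum_rank v))).
    by move=> z; exact: cvg_fst.
  exact: entry_continuous.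
- by move=> [p t]; rewrite /r /s /=; congr pair; apply/funext => v; rewrite mxE enum_rankK.
- exact: (@pseudometric_perfectly_normal R ('rV[R]_#|V| * R)%type).
Qed.

End PointwiseTopology.

(** * A tree is an absolute extensor *)

Section TreeIsExtensor.
Variables (R : realType) (V : finType) (e : rel V).
Local Notation P := {ptws V -> R}.

Definition vertex_point (v : V) : P := fun w => (w == v)%:R.

Definition subtree (A : {set V}) : set P :=
  [set p | exists c : {set V}, [/\ is_vertex c || is_edge e c, c \subset A & @closed_cell1 R V c p]].

Lemma cell1_vertex v p : closed_cell1 [set v]%SET p <-> p = vertex_point v.
Proof.
split=> [[p0 p1 pN]|->].
  apply/funext => w; rewrite /vertex_point; have [->|wv] := eqVneq w v; last by rewrite pN // inE.
  by rewrite -p1 (bigD1 v) //= big1 ?addr0 // => u uv; rewrite pN // inE.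
split=> [w|| w]; first by rewrite /vertex_point ler0n.
  by rewrite (bigD1 v) //= /vertex_point eqxx big1 ?addr0 // => u /negbTE ->.
by rewrite inE /vertex_point => /negbTE ->.
Qed.

Lemma cell1_edge u v p : u != v -> closed_cell1 [set u; v]%SET p <->
  exists2 t : R, 0 <= t <= 1 & p = fun w => (1 - t) * vertex_point u w + t * vertex_point v w.
Proof.
move=> uv; split=> [[p0 p1 pN]|[t /andP[t0 t1] ->]].
  have pvu : p u = 1 - p v.
    rewrite -p1 (bigD1 u) //= (bigD1 v) 1?eq_sym //= big1 ?addr0 ?addrK //.
    by move=> w /andP[wu wv]; rewrite pN // !inE (negbTE wu) (negbTE wv).
  exists (p v); first by rewrite p0 /=; have := p0 u; rewrite pvu subr_ge0.
  apply/funext => w; rewrite /vertex_point.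
  have [->|wu] := eqVneq w u; first by rewrite (negbTE uv) mulr1 mulr0 addr0 pvu.
  have [->|wv] := eqVneq w v; first by rewrite mulr0 add0r mulr1.
  by rewrite !mulr0 addr0 pN // !inE (negbTE wu) (negbTE wv).
split=> [w|| w].
- by apply: addr_ge0; apply: mulr_ge0; rewrite ?subr_ge0 // /vertex_point ler0n.
- rewrite big_split /= -!mulr_sumr.
  have h x : \sum_w vertex_point x w = 1.
    by rewrite (bigD1 x) //= /vertex_point eqxx big1 ?addr0 // => y /negbTE ->.
  by rewrite !h; ring.
- by rewrite !inE negb_or /vertex_point => /andP[/negbTE -> /negbTE ->]; rewrite !mulr0 addr0.
Qed.

Lemma closed_cell1_closed (A : {set V}) : closed (@closed_cell1 R V A).
Proof.
have ev v : continuous (fun p : P => p v) by exact: eval_ptws_continuous.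
have -> : @closed_cell1 R V A = (\bigcap_v [set p | 0 <= p v]) `&`
    ([set p | 1 <= \sum_v p v <= 1] `&` \bigcap_(v in [set v | v \notin A]) [set p | 0 <= p v <= 0]).
  apply/seteqP; split=> p.
    move=> [p0 p1 pN]; split; first by move=> v _; exact: p0.
    by split; [rewrite /= p1 lexx|move=> v vA; rewrite /= pN // lexx].
  move=> [p0 [p1 pN]]; split; first by move=> v; exact: p0.
    by apply/le_anti; rewrite andbC.
  by move=> v vA; apply/le_anti; rewrite andbC; exact: pN.
apply: closedI; first by apply: closed_bigI => v _; exact: (closed_pre (ev v) (@closed_ge _ 0)).
apply: closedI.
  by apply: (@closed_pre _ _ (fun p : P => \sum_v p v) _ _ (@closed_itv R 1 1)); exact: continuous_sum.
by apply: closed_bigI => v _; exact: (closed_pre (ev v) (@closed_itv R 0 0)).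
Qed.

(** The barycentric coordinate at [v] identifies the edge with [0, 1]. *)
Lemma AE_segment u v : u != v -> absolute_extensor R (@closed_cell1 R V [set u; v]%SET).
Proof.
move=> uv; pose a (t : R) : P := fun w => (1 - t) * vertex_point u w + t * vertex_point v w.
have ca : continuous a.
  apply: continuous_into_ptws => w; apply: (@continuous_add _ _ R^o).
    apply: continuous_mul; last exact: cst_continuous.
    apply: (@continuous_sub _ _ R^o); first exact: cst_continuous.
    by move=> t; exact: cvg_id.
  apply: continuous_mul; last exact: cst_continuous.
  by move=> t; exact: cvg_id.
have av t : a t v = t by rewrite /a /vertex_point eqxx eq_sym (negbTE uv) mulr0 mulr1 add0r.
apply: (@AE_retract R R P [set t : R | 0 <= t <= 1] _ a (fun p => p v)).
- exact: closed_itv.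
- by apply: AE_itv.
- by apply: continuous_onW => //; exact: closed_itv.
- apply: continuous_onW; first exact: closed_cell1_closed.
  exact: eval_ptws_continuous.
- by move=> t t01; apply/cell1_edge => //; exists t.
- by move=> p /cell1_edge => /(_ uv)[t t01 ->]; rewrite /= -/(a t v) av.
- move=> p /set_mem/cell1_edge => /(_ uv)[t t01 ->].
  by rewrite (_ : _ + _ = t) //; exact: av.
Qed.

Lemma subtree_closed (A : {set V}) : closed (subtree A).
Proof.
have -> : subtree A = \bigcup_(c in [set c : {set V} | (is_vertex c || is_edge e c) && (c \subset A)]) @closed_cell1 R V c.
  apply/seteqP; split=> p; first by move=> [c [h1 h2 h3]]; exists c => //=; rewrite h1.
  by move=> [c /= /andP[h1 h2] h3]; exists c.
by apply: closed_bigcup; [exact: finite_finset|move=> c _; exact: closed_cell1_closed].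
Qed.

Hypothesis e_tree : is_tree e.
Let e_sym : symmetric e. Proof. by case: e_tree. Qed.
Let e_irr : irreflexive e. Proof. by case: e_tree. Qed.

Let eA (A : {set V}) : rel V := [rel x y | [&& e x y, x \in A & y \in A]].

Let eA_path (A : {set V}) x p : x \in A -> path (eA A) x p -> path e x p /\ {subset x :: p <= A}.
Proof.
elim: p x => [|y p IH] x xA /=; first by split=> // z; rewrite inE => /eqP ->.
move=> /andP[/and3P[xy _ yA] /(IH _ yA)[-> sA]]; split; first by rewrite xy.
by move=> z; rewrite inE => /predU1P[->//|]; exact: sA.
Qed.

(** Otherwise a simple path inside [A] from [u] to [w], closed up through [v], would be a circuit of
    length at least 3. *)
Let unique_neighbour (A : {set V}) v w u : (forall x y, x \in A -> y \in A -> connect (eA A) x y) ->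
  v \notin A -> w \in A -> u \in A -> e v w -> e v u -> u = w.
Proof.
move=> cA vA wA uA vw vu; have /connectP[p0 p0p wE] := cA u w uA wA.
case/shortenP: p0p wE => p pp up _ wE.
have [ep sA] := eA_path uA pp; apply/eqP; apply: contraT => uw.
have [_ _ _ _ /(_ [:: v, u & p])] := e_tree.
case: p wE pp up ep sA => [/= wE|x p wE pp up ep sA]; first by rewrite wE eqxx in uw.
suff uc : ucycle e [:: v, u, x & p] by move/(_ uc).
rewrite /ucycle /cycle; apply/andP; split.
  by move: ep wE => /= /andP[ux xp] wE; rewrite rcons_path /= vu ux xp -wE e_sym vw.
by rewrite cons_uniq up andbT; apply/negP => /sA; apply/negP.
Qed.

Let grow (A : {set V}) (x : V) : x \in A -> A != [set: V]%SET ->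
  exists v w, [/\ v \notin A, w \in A & e w v].
Proof.
move=> xA AT; have [y yA] : exists y, y \notin A.
  apply: contrapT => h; move/eqP: AT; apply; apply/setP => y; rewrite inE.
  by apply: contraT => yA; case: h; exists y.
have [_ _ _ /(_ x y)/connectP[p pp yE] _] := e_tree.
elim: p x xA pp yE => [|z p IH] x xA /=; first by move=> _ yE; rewrite yE xA in yA.
move=> /andP[xz zp] yE; have [zA|zA] := boolP (z \in A); first exact: (IH z).
by exists z, x.
Qed.

(** A connected vertex set is enlarged by one adjacent vertex [v] at a time. By [unique_neighbour]
    this attaches a single edge to the subtree, and attaches it along a single point. *)
Let tree_exhaustion j : (0 < j <= #|V|)%N -> exists A : {set V}, [/\ #|A| = j,
  forall x y, x \in A -> y \in A -> connect (eA A) x y & absolute_extensor R (subtree A)].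
Proof.
elim: j => // -[|j] IH /= jV.
  have [x _] : exists x : V, x \in V by apply/card_gt0P.
  exists [set x]%SET; rewrite cards1; split=> //.
    by move=> y z; rewrite !inE => /eqP -> /eqP ->; exact: connect0.
  rewrite (_ : subtree _ = [set vertex_point x]); first exact: AE_set1.
  apply/seteqP; split=> p; last first.
    move=> ->; exists [set x]%SET; split; rewrite ?fintype.subxx //; last exact/cell1_vertex.
    by apply/orP; left; apply/existsP; exists x.
  move=> [c [/orP[/existsP[y /eqP ->]|/existsP[y /existsP[z /andP[yz /eqP ->]]]] cx pc]].
    by move: cx pc; rewrite finset.sub1set inE => /eqP -> /cell1_vertex.
  move: cx; rewrite finset.subUset !finset.sub1set !inE => /andP[/eqP yx /eqP zx].
  by rewrite yx zx e_irr in yz.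
have [A [cA coA aA]] := IH (ltnW jV).
have [x xA] : exists x, x \in A by apply/card_gt0P; rewrite cA.
have [v [w [vA wA wv]]] : exists v w, [/\ v \notin A, w \in A & e w v].
  apply: (grow xA); apply: contraTneq jV => AT.
  by move: cA; rewrite AT finset.cardsT => ->; rewrite ltnn.
have vw : e v w by rewrite e_sym.
have wNv : w != v by apply: contraNneq vA => <-.
exists (v |: A)%SET; split; first by rewrite cardsU1 vA cA.
  have sub : subrel (connect (eA A)) (connect (eA (v |: A)%SET)).
    apply: connect_sub => y z /and3P[yz yA zA]; apply: connect1.
    by rewrite /eA /= yz !inE yA zA !orbT.
  have cvw : connect (eA (v |: A)%SET) v w by apply: connect1; rewrite /eA /= vw !inE eqxx wA orbT.
  have cwv : connect (eA (v |: A)%SET) w v by apply: connect1; rewrite /eA /= wv !inE eqxx wA orbT.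
  move=> y z; rewrite !inE => /predU1P[->|yA] /predU1P[->|zA]; first exact: connect0.
  - by apply: (connect_trans cvw); apply: sub; exact: coA.
  - by apply: (connect_trans _ cwv); apply: sub; exact: coA.
  - by apply: sub; exact: coA.
have seg_edge : is_edge e [set w; v]%SET by apply/existsP; exists w; apply/existsP; exists v; rewrite wv eqxx.
have -> : subtree (v |: A)%SET = subtree A `|` @closed_cell1 R V [set w; v]%SET.
  apply/seteqP; split=> p; last first.
    move=> [[c [h1 h2 h3]]|h]; first by exists c; split=> //; rewrite (fintype.subset_trans h2) // finset.subsetUr.
    exists [set w; v]%SET; split=> //; first by rewrite seg_edge orbT.
    by rewrite finset.subUset !finset.sub1set !inE eqxx wA orbT.
  move=> [c [cc cA' pc]]; have [vc|vc] := boolP (v \in c); last first.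
    left; exists c; split=> //; apply/fintype.subsetP => y yc.
    have := fintype.subsetP cA' y yc; rewrite !inE => /predU1P[yv|//].
    by rewrite yv (negbTE vc) in yc.
  right; case/orP: cc => [/existsP[y /eqP cE]|/existsP[y /existsP[z /andP[yz /eqP cE]]]].
    move: vc pc; rewrite cE inE => /eqP <- /cell1_vertex ->.
    apply/cell1_edge => //; exists 1; first by rewrite ler01 lexx.
    by apply/funext => u; rewrite subrr mul0r add0r mul1r.
  have nb u : u \in c -> u != v -> e v u -> u = w.
    move=> uc uv vu; apply: (unique_neighbour coA vA wA _ vw vu).
    by have := fintype.subsetP cA' u uc; rewrite !inE (negbTE uv).
  have yNz : y != z by apply: contraTneq yz => ->; rewrite e_irr.
  move: vc; rewrite cE !inE => /orP[/eqP vy|/eqP vz].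
    move: pc; rewrite cE -vy finset.setUC (nb z) //.
    - by rewrite cE !inE eqxx orbT.
    - by rewrite vy eq_sym.
    - by rewrite vy.
  move: pc; rewrite cE -vz (nb y) //.
  - by rewrite cE !inE eqxx.
  - by rewrite vz.
  - by rewrite vz e_sym.
apply: AE_glue => //.
- exact: subtree_closed.
- exact: closed_cell1_closed.
- exact: AE_segment.
rewrite (_ : _ `&` _ = [set vertex_point w]); first exact: AE_set1.
apply/seteqP; split=> p; last first.
  move=> ->; split.
    exists [set w]%SET; split; rewrite ?finset.sub1set //; last exact/cell1_vertex.
    by apply/orP; left; apply/existsP; exists w.
  apply/cell1_edge => //; exists 0; first by rewrite ler01 lexx.
  by apply/funext => u; rewrite subr0 mul0r addr0 mul1r.
move=> [[c [_ cA' [_ _ pN]]] /cell1_edge pe]; have [t t01 pE] := pe wNv.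
have : p v = 0.
  by apply: pN; apply: contra vA; exact: fintype.subsetP.
rewrite pE /vertex_point eqxx eq_sym (negbTE wNv) mulr0 add0r mulr1 => t0.
by rewrite /= t0; apply/funext => u; rewrite subr0 mul0r addr0 mul1r.
Qed.

Lemma tree_AE : absolute_extensor R (subtree [set: V]%SET).
Proof.
have [_ _ V0 _ _] := e_tree.
have [|A [cA _ aA]] := tree_exhaustion (j := #|V|); first by rewrite V0 leqnn.
suff <- : A = [set: V]%SET by [].
by apply/eqP; rewrite eqEcard finset.subsetT finset.cardsT cA leqnn.
Qed.

End TreeIsExtensor.

(** * From the tree to the interval *)

(** Maps and homotopies are given on the ambient spaces, where continuity can be checked coordinate
    by coordinate; the price is that the subspaces must be preserved at all real times. *)
Lemma hequiv_subtypes (R : realType) (E E' : topologicalType) (A : set E) (B : set E')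
    (F : E -> E') (G : E' -> E) (K : E * R -> E) (L : E' * R -> E') :
  continuous F -> continuous G -> continuous K -> continuous L ->
  (forall x, A x -> B (F x)) -> (forall y, B y -> A (G y)) ->
  (forall x t, A x -> A (K (x, t))) -> (forall y t, B y -> B (L (y, t))) ->
  (forall x, A x -> K (x, 0) = x /\ K (x, 1) = G (F x)) ->
  (forall y, B y -> L (y, 0) = y /\ L (y, 1) = F (G y)) -> hequiv R A B.
Proof.
move=> cF cG cK cL AB BA AK BL K01 L01.
have vA (x : A) : A (val x) by apply/set_mem/valP.
have vB (y : B) : B (val y) by apply/set_mem/valP.
have lift (X Y : topologicalType) (C : set X) (h : X * R -> Y) : continuous h ->
    continuous (fun z : C * R => h (val z.1, z.2)).
  move=> ch; apply: (@continuous_compose (C * R)%type (X * R)%type Y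
    (fun z => (val z.1, z.2)) h) => //.
  apply: continuous_pair; last by move=> z; exact: cvg_snd.
  apply: (@continuous_compose (C * R)%type C X (fun z => z.1) val); last exact: continuous_val.
  by move=> z; exact: cvg_fst.
pose f (x : A) : B := SigSub (mem_set (AB _ (vA x))).
pose g (y : B) : A := SigSub (mem_set (BA _ (vB y))).
pose k (z : A * R) : A := SigSub (mem_set (AK _ z.2 (vA z.1))).
pose l (z : B * R) : B := SigSub (mem_set (BL _ z.2 (vB z.1))).
exists f, g; split.
- apply: continuous_into_subtype.
  by apply: (@continuous_compose A E E' val F) => //; exact: continuous_val.
- apply: continuous_into_subtype.
  by apply: (@continuous_compose B E' E val G) => //; exact: continuous_val.
- apply: homot_sym; exists k; split.
  + by apply: continuous_into_subtype; exact: lift.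
  + by move=> x; apply/val_inj => /=; case: (K01 _ (vA x)).
  + by move=> x; apply/val_inj => /=; case: (K01 _ (vA x)).
- apply: homot_sym; exists l; split.
  + by apply: continuous_into_subtype; exact: lift.
  + by move=> y; apply/val_inj => /=; case: (L01 _ (vB y)).
  + by move=> y; apply/val_inj => /=; case: (L01 _ (vB y)).
Qed.

Section Transfer.
Variables (R : realType) (V : finType) (e : rel V) (S : {set V}) (n : nat).
Hypotheses (e_tree : is_tree e) (S0 : (0 < #|S|)%N).
Local Notation P := {ptws V -> R}.
Local Notation T := (@subtree R V e [set: V]%SET).

(** A vertex point also lies in the closed edges around it, but only vertex entries count for the
    support. The carrying cell is therefore chosen to be the vertex itself whenever the coordinate
    is a vertex point. *)
Lemma realization_Str (x : {ptws 'I_n -> P}) : realization R (Str e n S) x <->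
  (forall i, T (x i)) /\ forall s, s \in S -> exists i, x i = @vertex_point R V s.
Proof.
split.
  move=> [c /= + xc]; rewrite inE => /andP[/forallP cc /fintype.subsetP Sc]; split.
    by move=> i; exists (c i); split; rewrite ?finset.subsetT.
  move=> s /Sc; rewrite inE => /existsP[i /eqP ci]; exists i.
  by apply/cell1_vertex; rewrite -ci.
move=> [xT xS].
have /choice[c cP] : forall i, exists c : {set V}, [/\ is_vertex c || is_edge e c,
    closed_cell1 c (x i) & forall s, x i = @vertex_point R V s -> c = [set s]%SET].
  move=> i; have [[s xs]|ns] := pselect (exists s, x i = @vertex_point R V s).
    exists [set s]%SET; split; first by apply/orP; left; apply/existsP; exists s.
      exact/cell1_vertex.
    move=> s'; rewrite xs => /(congr1 (fun g : P => g s)); rewrite /vertex_point eqxx.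
    by case: eqP => [->//|_] /eqP; rewrite oner_eq0.
  by have [c [h1 _ h2]] := xT i; exists c; split=> // s xs; case: ns; exists s.
exists [ffun i => c i]; last by move=> i; rewrite ffunE; case: (cP i).
rewrite /= inE; apply/andP; split.
  by apply/forallP => i; rewrite ffunE; case: (cP i).
apply/fintype.subsetP => s /xS[i xi]; rewrite inE; apply/existsP; exists i.
by rewrite ffunE; case: (cP i) => _ _ /(_ _ xi) ->.
Qed.

Let k := #|S|.
Let m := k.-1.
(** Marked vertices are numbered by their rank in [enum S]. The others have index [k] and are
    lowered to [m], which keeps the affine extension [phi] inside [0, m]. *)
Let nu v := minn (index v (enum S)) m.
Let s0 : V. Proof. by move: S0 => /card_gt0P/cid[s _]; exact: s. Defined.
Let sv j := nth s0 (enum S) j.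

Let size_enum : size (enum S) = k. Proof. by rewrite -cardE. Qed.

Let sv_S j : (j < k)%N -> sv j \in S.
Proof. by move=> jk; rewrite -mem_enum mem_nth ?size_enum. Qed.

Let nu_sv j : (j < k)%N -> nu (sv j) = j.
Proof.
move=> jk; rewrite /nu /sv index_uniq ?enum_uniq ?size_enum //.
by apply/minn_idPl; rewrite /m; move: jk; case: k.
Qed.

Let sv_nu s : s \in S -> (nu s < k)%N /\ sv (nu s) = s.
Proof.
move=> sS; have ik : (index s (enum S) < k)%N by rewrite -size_enum index_mem mem_enum.
have e' : nu s = index s (enum S).
  by rewrite /nu; apply/minn_idPl; rewrite /m; move: ik; case: k.
by rewrite e' /sv nth_index ?mem_enum.
Qed.

Let vertex_pointT s : T (@vertex_point R V s).
Proof.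
exists [set s]%SET; split; rewrite ?finset.subsetT //; last exact/cell1_vertex.
by apply/orP; left; apply/existsP; exists s.
Qed.

Let phi (p : P) : R := \sum_v p v * (nu v)%:R.

Let phi_vertex_point v : phi (@vertex_point R V v) = (nu v)%:R.
Proof.
rewrite /phi (bigD1 v) //= /vertex_point eqxx mul1r big1 ?addr0 // => u /negbTE ->.
by rewrite mul0r.
Qed.

Let phi_cont : continuous phi.
Proof.
apply: continuous_sum => v; apply: continuous_mul; last exact: cst_continuous.
exact: eval_ptws_continuous.
Qed.

Let phi_itv p : T p -> 0 <= phi p <= m%:R.
Proof.
move=> [c [_ _ [p0 p1 _]]]; apply/andP; split.
  by apply: sumr_ge0 => v _; rewrite mulr_ge0.
have -> : m%:R = \sum_v p v * m%:R by rewrite -mulr_suml p1 mul1r.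
by apply: ler_sum => v _; apply: ler_wpM2l => //; rewrite ler_nat geq_minr.
Qed.

(** The way back to the tree: integers below [k] go to their marked vertices, and the extensor
    property of the tree fills in the rest. *)
Let gamma_ex : exists g : R -> P, [/\ continuous g, forall r, T (g r) &
  forall j, (j < k)%N -> g j%:R = @vertex_point R V (sv j)].
Proof.
have [f cf fE] : exists2 f : R -> P, continuous_on (\bigcup_(j : 'I_k) [set (j%:R : R)]) f &
    forall (j : 'I_k) r, [set (j%:R : R)] r -> f r = @vertex_point R V (sv j).
  apply: (@glue_family 'I_k R P (fun j => [set (j%:R : R)]) (fun j _ => @vertex_point R V (sv j))).
  - exact: (@vertex_point R V s0).
  - by move=> j; apply: continuous_onW; [exact: closed_eq|exact: cst_continuous].
  - by move=> i j r /= -> /eqP; rewrite eqr_nat => /eqP ->.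
have [r [j _ rj]|g [cg gf gT]] := tree_AE e_tree (@pseudometric_perfectly_normal R R) cf.
  by rewrite (fE j).
exists g; split=> // j jk; rewrite gf; first by rewrite (fE (Ordinal jk)).
by rewrite inE; exists (Ordinal jk).
Qed.

(** An extension problem with data at times 0 and 1 and, for all times, at the marked vertices.
    Keeping these fixed is what makes the coordinatewise homotopy preserve the realization. *)
Let tree_homotopy (g : R -> P) : continuous g -> (forall r, T (g r)) ->
  (forall j, (j < k)%N -> g j%:R = @vertex_point R V (sv j)) ->
  exists h : P * R -> P, [/\ continuous h, forall z, T (h z),
    forall p, T p -> h (p, 0) = p /\ h (p, 1) = g (phi p) &
    forall s t, s \in S -> h (@vertex_point R V s, t) = @vertex_point R V s].
Proof.
move=> cg gT gv.
pose A (c : bool + V) : set (P * R) := match c with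
  | inl b => [set z | T z.1 /\ z.2 = b%:R]
  | inr v => [set z | v \in S /\ z.1 = @vertex_point R V v] end.
pose f0 (c : bool + V) : P * R -> P := match c with
  | inl b => fun z => if b then g (phi z.1) else z.1
  | inr v => fun=> @vertex_point R V v end.
have cfst : continuous (fun z : P * R => z.1) by move=> z; exact: cvg_fst.
have csnd : continuous (fun z : P * R => z.2) by move=> z; exact: cvg_snd.
have gphi s : s \in S -> g (phi (@vertex_point R V s)) = @vertex_point R V s.
  by move=> /sv_nu[nk sE]; rewrite phi_vertex_point gv // sE.
have [f cf fE] : exists2 f : P * R -> P, continuous_on (\bigcup_c A c) f &
    forall c z, A c z -> f z = f0 c z.
  apply: glue_family; first exact: (@vertex_point R V s0).
    move=> [b|v]; apply: continuous_onW.
    - apply: closedI; first exact: (closed_pre cfst (@subtree_closed R V e _)).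
      exact: (closed_pre csnd (@closed_eq R b%:R)).
    - case: b => //=; apply: (@continuous_compose _ P P (fun z => z.1) (g \o phi)) => //.
      exact: continuous_compose.
    - have [vS|vS] := boolP (v \in S); last first.
        rewrite (_ : A _ = set0); first exact: closed0.
        by apply/seteqP; split=> // z [/=]; rewrite (negbTE vS).
      rewrite (_ : A _ = (fun z => z.1) @^-1` @closed_cell1 R V [set v]%SET).
        by apply: closed_pre => //; exact: closed_cell1_closed.
      by apply/seteqP; split=> z /=; [case=> _ /cell1_vertex|move/cell1_vertex].
    - exact: cst_continuous.
  have mix b v z : A (inl b) z -> A (inr v) z -> f0 (inl b) z = f0 (inr v) z.
    by move=> _ [/= vS ->]; case: b => //=; exact: gphi.
  move=> [b|v] [b'|v'] z //=; [|exact: mix|by move=> h1 h2; apply/esym; exact: mix|].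
    by move=> [_ ->] [_] /eqP; rewrite eqr_nat; case: b b' => -[].
  by move=> [_ ->] [_ ->].
have [z [c _ cz]|h [ch hf hT]] := tree_AE e_tree (@perfectly_normal_ptws R V) cf.
  rewrite (fE c) //; case: c cz => [[] [? ?]|v _] /=; [exact: gT|by []|exact: vertex_pointT].
have hE c z : A c z -> h z = f0 c z.
  by move=> cz; rewrite hf ?(fE c) // inE; exists c.
exists h; split=> // [p Tp|s t sS]; last by rewrite (hE (inr s)).
by rewrite (hE (inl false)) ?(hE (inl true)).
Qed.

Lemma Str_space_interval : hequiv R (Str_space R e n S) (@hitting R m n (iota 0 k)).
Proof.
have [g [cg gT gv]] := gamma_ex.
have [h [ch hT h01 hS]] := tree_homotopy cg gT gv.
pose F (x : {ptws 'I_n -> P}) : 'rV[R]_n := \row_i phi (x i).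
pose G (y : 'rV[R]_n) : {ptws 'I_n -> P} := fun i => g (y 0 i).
pose K (z : {ptws 'I_n -> P} * R) : {ptws 'I_n -> P} := fun i => h (z.1 i, z.2).
(* The straight line from the identity to [phi \o g], clamped so as to stay in the interval at all
   real times. It fixes the marked integers, as [phi \o g] does. *)
pose L (z : 'rV[R]_n * R) : 'rV[R]_n :=
  \row_i clamp 0 m%:R (z.1 0 i + z.2 * (phi (g (z.1 0 i)) - z.1 0 i)).
have phig j : (j < k)%N -> phi (g j%:R) = j%:R.
  by move=> jk; rewrite gv // phi_vertex_point nu_sv.
have jm j : (j < k)%N -> (0 : R) <= j%:R <= m%:R.
  by move=> jk; rewrite ler0n ler_nat /m; move: jk; case: (k).
have iotaP j : j \in iota 0 k -> (j < k)%N by rewrite mem_iota.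
apply: (@hequiv_subtypes R {ptws 'I_n -> P} 'rV[R]_n _ _ F G K L).
- apply: continuous_row => i.
  rewrite (_ : (fun z => _) = (fun x : {ptws 'I_n -> P} => phi (x i))).
    apply: (@continuous_compose _ P R (fun x : {ptws 'I_n -> P} => x i) phi) => //.
    exact: eval_ptws_continuous.
  by apply/funext => x; rewrite mxE.
- apply: continuous_into_ptws => i.
  apply: (@continuous_compose _ R P (fun y : 'rV[R]_n => y 0 i) g) => //.
  exact: entry_continuous.
- apply: continuous_into_ptws => i.
  apply: (@continuous_compose ({ptws 'I_n -> P} * R)%type (P * R)%type P
    (fun z => (z.1 i, z.2)) h) => //.
  apply: continuous_pair; last by move=> z; exact: cvg_snd.
  apply: (@continuous_compose ({ptws 'I_n -> P} * R)%type {ptws 'I_n -> P} P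
    (fun z => z.1) (fun x => x i)); last exact: eval_ptws_continuous.
  by move=> z; exact: cvg_fst.
- apply: continuous_row => i.
  have ci : continuous (fun z : 'rV[R]_n * R => z.1 0 i).
    apply: (@continuous_compose _ 'rV[R]_n R (fun z => z.1) (fun x => x 0 i)).
      by move=> z; exact: cvg_fst.
    exact: entry_continuous.
  rewrite (_ : (fun z => _) = (fun z : 'rV[R]_n * R =>
      clamp 0 m%:R (z.1 0 i + z.2 * (phi (g (z.1 0 i)) - z.1 0 i)))); last first.
    by apply/funext => x; rewrite mxE.
  apply: (@continuous_compose _ R R
    (fun z : 'rV[R]_n * R => z.1 0 i + z.2 * (phi (g (z.1 0 i)) - z.1 0 i))
    (clamp 0 m%:R)); last exact: clamp_continuous.
  apply: (@continuous_add _ _ R^o) => //; apply: continuous_mul.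
    by move=> z; exact: cvg_snd.
  apply: (@continuous_sub _ _ R^o) => //.
  apply: (@continuous_compose _ R R (fun z : 'rV[R]_n * R => z.1 0 i) (phi \o g)) => //.
  exact: continuous_compose.
- move=> x /realization_Str[xT xS]; split=> [i|j /iotaP jk]; first by rewrite mxE phi_itv.
  have [i xi] := xS _ (sv_S jk); exists i.
  by rewrite mxE xi phi_vertex_point nu_sv.
- move=> y [yJ yS]; apply/realization_Str; split=> [i|s sS]; first exact: gT.
  have [sk sE] := sv_nu sS; have [|i yi] := yS (nu s); first by rewrite mem_iota.
  by exists i; rewrite /G yi gv // sE.
- move=> x t /realization_Str[xT xS]; apply/realization_Str; split=> [i|s sS]; first exact: hT.
  by have [i xi] := xS s sS; exists i; rewrite /K /= xi hS.
- move=> y t [yJ yS]; split=> [i|j jk]; first by rewrite mxE clamp_itv.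
  have [i yi] := yS j jk; exists i; rewrite mxE /= yi phig ?iotaP // subrr mulr0 addr0.
  by rewrite clamp_id // jm ?iotaP.
- move=> x /realization_Str[xT xS]; split; apply/funext => i.
    by case: (h01 _ (xT i)).
  by rewrite /K /G /F /= mxE; case: (h01 _ (xT i)).
- move=> y [yJ yS]; split; apply/rowP => i; rewrite !mxE /=.
    by rewrite mul0r addr0 clamp_id.
  by rewrite mul1r addrC subrK clamp_id // phi_itv.
Qed.

End Transfer.

Theorem theorem2p5 (R : realType) (V : finType) (e : rel V)
    (S : {set V}) (n : nat) :
  is_tree e -> (2 <= #|V|)%N -> (2 <= #|S|)%N -> (#|S| <= n)%N ->
  exists N : nat,
    N%:Z = num_spheres #|S| n /\
    homotopy_equivalent R (Str_space R e n S) (wedge_spheres R (n - #|S|) N).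
Proof.
(* In the interval the marked points are 0, ..., |S| - 1, which explains the right end [#|S|.-1];
   the position of [S] in the tree no longer matters. *)
move=> e_tree _ S2 Sn; pose I := iota 0 #|S|.
have sI : size I = #|S| by rewrite size_iota.
have srt : sorted ltn I by exact: iota_ltn_sorted.
have aI : all (fun s => s <= #|S|.-1)%N I.
  by apply/allP => s; rewrite mem_iota /=; lia.
have sn : (1 < size I <= n)%N by rewrite sI S2.
exists (size (removed_words n I)); split; first by rewrite size_removed_words ?iota_uniq ?sI.
apply: hequiv_homotopy_equivalent.
apply: (hequiv_trans (Str_space_interval R n e_tree (ltnW S2))).
by have := hitting_wedge R srt aI sn; rewrite sI.
Qed.
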